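(* Let $n\ge 3$ and let $e$ be an edge of the complete graph $K_{n+1}$ on $\{0,1,\dots,n\}$ joining distinct vertices $i,j\in[n]$. Then the number of spherical parking functions of $K_{n+1}-\{e\}$ (with root $0$) is \[ |\mathrm{sPF}(K_{n+1}-\{e\})|=|\mathcal{U}_n'|=(n-1)^{n-3}(n-2)^2 . \]
   Context: $\mathbb{N}=\{0,1,2,\dots\}$, $[n]=\{1,\dots,n\}$. $K_{n+1}$ is the complete simple graph on $V=\{0,1,\dots,n\}$ with root $0$; $K_{n+1}-\{e\}$ is the graph on $V$ obtained by deleting the edge $e$. Spherical parking functions: let $R=\mathbb{K}[x_1,\dots,x_n]$ over a field $\mathbb{K}$. For an undirected loopless graph $G$ on $V$ with $a_{ij}$ edges between $i$ and $j$, and $\emptyset\ne A\subseteq[n]$, put $d_A(i)=\sum_{j\in V\setminus A}a_{ij}$ and $m_A=\prod_{i\in A}x_i^{d_A(i)}$. Let $\mathcal{M}_G=\langle m_A:\emptyset\neq A\subseteq[n]\rangle$ and $\mathcal{M}_G^{(k)}=\langle m_A:\emptyset\ne A\subseteq[n],\ |A|\le k+1\rangle$ for $0\le k\le n-1$. Then $\mathrm{sPF}(G)=\{(p_1,\dots,p_n)\in\mathbb{N}^n:\ \prod_i x_i^{p_i}\in\mathcal{M}_G\setminus\mathcal{M}_G^{(n-2)}\}$. Uprooted trees: a rooted labelled tree on vertex set $[n]$ is uprooted if its root is larger than all children of the root. $\mathcal{U}_n'$ is the set of uprooted trees on $[n]$ in which the vertices $1$ and $n$ are not adjacent. *)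

(* Defs.v *)
From mathcomp Require Import all_boot all_order all_algebra.
From mathcomp Require Import mpoly.
Set Implicit Arguments.
Unset Strict Implicit.
Unset Printing Implicit Defensive.
Import GRing.Theory.
Local Open Scope nat_scope.

(* P holds of exactly N elements; in particular, P defines a finite set. *)
Definition has_card (T : eqType) (P : T -> Prop) (N : nat) : Prop :=
  exists s : seq T, [/\ uniq s, forall x, x \in s <-> P x & size s = N].

Record mgraph (V : finType) := MGraph {
  nedges :> V -> V -> nat;
  nedges_sym : forall u v, nedges u v = nedges v u;
  nedges_loopless : forall u, nedges u u = 0 }.

(* K_{n+1} has vertex set {0, ..., n} = 'I_n.+1. *)
Program Definition complete_graph (n : nat) : mgraph 'I_n.+1 :=
  @MGraph _ (fun u v => (u != v) : nat) _ _.
Next Obligation. by rewrite eq_sym. Qed.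
Next Obligation. by rewrite eqxx. Qed.

(* Removes one edge joining x and y, if there is any. *)
Program Definition del_edge (V : finType) (G : mgraph V) (x y : V) : mgraph V :=
  @MGraph _ (fun u v => G u v - ([set u; v] == [set x; y])) _ _.
Next Obligation. by rewrite nedges_sym setUC. Qed.
Next Obligation. by rewrite nedges_loopless. Qed.

Definition ideal_gen (R : comNzRingType) (S : R -> Prop) (p : R) : Prop :=
  exists s : seq (R * R),
    (forall cg, cg \in s -> S cg.2) /\ p = (\sum_(cg <- s) cg.1 * cg.2)%R.

Section SphericalParkingFunctions.
Variables (K : fieldType) (n : nat) (G : mgraph 'I_n.+1).

(* The variables x_1, ..., x_n are 'X_i with i : 'I_n, and the variable 'X_i
   belongs to the nonzero vertex lift ord0 i, of value i.+1.  Subsets A of [n]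
   are likewise sets A : {set 'I_n}. *)
Definition vtx (i : 'I_n) : 'I_n.+1 := lift ord0 i.

Definition outdeg (A : {set 'I_n}) (i : 'I_n) : nat :=
  \sum_(v in ~: (vtx @: A)) G (vtx i) v.

Definition mono (A : {set 'I_n}) : {mpoly K[n]} :=
  (\prod_(i in A) 'X_i ^+ outdeg A i)%R.

Definition idealM : {mpoly K[n]} -> Prop :=
  ideal_gen (fun g => exists A : {set 'I_n}, A != set0 /\ g = mono A).

Definition skeletonM (k : nat) : {mpoly K[n]} -> Prop :=
  ideal_gen (fun g => exists A : {set 'I_n},
    [/\ A != set0, #|A| <= k.+1 & g = mono A]).

Definition sPF (p : {ffun 'I_n -> nat}) : Prop :=
  let xp : {mpoly K[n]} := (\prod_(i < n) 'X_i ^+ p i)%R in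
  idealM xp /\ ~ skeletonM (n - 2) xp.

End SphericalParkingFunctions.

Section Trees.
Variable T : finType.
Implicit Types E : {set {set T}}.

Definition adj E : rel T := fun x y => [set x; y] \in E.

Definition is_tree E : Prop :=
  [/\ forall e, e \in E -> #|e| = 2,
      forall x y, connect (adj E) x y
    & forall c : seq T, 2 < size c -> ~ ucycle (adj E) c].

End Trees.

(* A rooted tree on [n] is a pair of its root and its edge set; the label k of
   [n] is the element of value k.-1 of 'I_n. The children of the root are its
   neighbours. *)
Definition uprooted (n : nat) (t : 'I_n * {set {set 'I_n}}) : Prop :=
  is_tree t.2 /\ forall v, adj t.2 t.1 v -> v < t.1.

(* Members of value 0 and n.-1 of 'I_n are the labels 1 and n. *)
Definition uprooted' (n : nat) (t : 'I_n * {set {set 'I_n}}) : Prop :=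
  uprooted t /\
  forall u v : 'I_n, u = 0 :> nat -> v = n.-1 :> nat -> ~~ adj t.2 u v.

(* Main.v *)
Require Import Defs.
From mathcomp Require Import all_boot all_order all_algebra.
From mathcomp Require Import mpoly ring zify.
Set Implicit Arguments.
Unset Strict Implicit.
Unset Printing Implicit Defensive.
Local Open Scope nat_scope.

(** Both families are counted by one recursion.  Forests with nonroots [S] and
    [k] roots are counted by processing one root: its set [L] of children
    becomes a set of roots, and [(S, k)] is replaced by [(S \ L, k + |L| - 1)].
    A spherical parking function [p] of a complete graph is, with [q = p - 1], a
    function such that [#{q < m} > m] for [1 <= m <= n - 1]; reading off its level
    [L = {q = m}] changes the set [S] of arguments still to be read and the excess
    [k = #{q < m} - m] in the same way.  Deleting the edge [ab] adds the condition
    [#{q <= M} > M + 2] where [M = max (q a) (q b)], and the numbers of functions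
    satisfying it obey the recursions of forests in which [a] and [b] are not
    adjacent.  The first step is that of an uprooted tree: its root together with
    the children of the root form an arbitrary nonempty set [W], whose maximum is
    the root; [W] plays the role of the level [q = 0]. *)

(** * Numbers of forests *)

(* Forests with [s] nonroots and [k] roots: [k (k + s) ^ (s - 1)]. *)
Definition forests (s k : nat) : nat :=
  if s is s'.+1 then k * (k + s) ^ s' else 1.

(* The same with one more nonroot [b] and a distinguished root [a] that is not
   the parent of [b]. *)
Definition forests1 (s k : nat) : nat :=
  if k is k'.+1 then k' * (k + s).+1 ^ s + s * (k + s).+1 ^ s.-1 else 0.

(* The same with two more nonroots that are not adjacent. *)
Definition forests2 (s k : nat) : nat := k * (k + s) * (k + s).+2 ^ s.

Section ForestNumbers.
Import GRing.Theory.

(** The binomial theorem and its derivative in one identity. In the recursions [T] does not depend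
    on [l], because turning [l] nonroots into roots preserves the number of vertices. *)
Lemma sum_bin_affine (s T : nat) (al be : int) :
  ((T%:R + 1) * \sum_(l < s.+1) 'C(s, l)%:R * ((al + be * l%:R) * T%:R ^+ (s - l))
   = (al * (T%:R + 1) + be * s%:R) * (T%:R + 1) ^+ s :> int)%R.
Proof.
elim: s al be => [|s IH] al be.
  by rewrite big_ord1 bin0 subn0 !expr0 /=; ring.
rewrite big_ord_recl bin0 subn0.
under eq_bigr => l _ do rewrite lift0 binS natrD mulrDl subSS.
rewrite big_split /= mulrDr mulrDr.
have -> : (\sum_(l < s.+1) 'C(s, l)%:R * ((al + be * (l : nat).+1%:R) * T%:R ^+ (s - l))
  = \sum_(l < s.+1) 'C(s, l)%:R * (((al + be) + be * l%:R) * T%:R ^+ (s - l)) :> int)%R.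
  by apply: eq_bigr => l _; congr (_ * (_ * _))%R; rewrite -natr1; ring.
have -> : (\sum_(l < s.+1) 'C(s, l.+1)%:R * ((al + be * (l.+1)%:R) * T%:R ^+ (s - l)) =
  T%:R * \sum_(l < s.+1) 'C(s, l)%:R * ((al + be * l%:R) * T%:R ^+ (s - l))
  - al * T%:R ^+ s.+1 :> int)%R.
  rewrite big_ord_recr /= bin_small // mul0r addr0.
  rewrite [in RHS]big_ord_recl bin0 subn0 mulrDr mulr_sumr.
  rewrite [X in _ = (X + _ - _)%R](_ : _ = (al * T%:R ^+ s.+1)%R); last by rewrite exprS /=; ring.
  rewrite addrAC subrr add0r; apply: eq_bigr => l _.
  by rewrite lift0 (_ : s - l = (s - l.+1).+1) ?exprS; [ring | have := ltn_ord l; lia].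
rewrite mulrBr [(_ * (T%:R * _))%R]mulrCA !IH -natr1 !exprS; ring.
Qed.

(** Forest numbers may carry an exponent one below [s - l]; the factor [T] repairs this, and [int]
    allows subtraction in the coefficients. *)
Lemma sum_bin_affine_eq (s T : nat) (al be : int) (F : nat -> nat) (x : int) : 0 < T ->
  (forall l, l <= s -> (T%:R * (F l)%:R = (al + be * l%:R) * T%:R ^+ (s - l) :> int)%R) ->
  (((al * (T%:R + 1) + be * s%:R) * (T%:R + 1) ^+ s = T%:R * (T%:R + 1) * x :> int)%R) ->
  ((\sum_(l < s.+1) 'C(s, l) * F l)%:R = x :> int)%R.
Proof.
move=> T0 HF Hx.
have Tn0 : (T%:R * (T%:R + 1) != 0 :> int)%R by lia.
apply: (mulfI Tn0); rewrite -Hx -sum_bin_affine mulrAC [RHS]mulrC; congr (_ * _)%R.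
rewrite natr_sum mulr_sumr; apply: eq_bigr => l _.
by rewrite natrM mulrCA HF // -ltnS.
Qed.

Lemma forests_mul s k : (k + s) * forests s k = k * (k + s) ^ s.
Proof. by case: s => [|s] /=; rewrite ?addn0 // expnS mulnCA. Qed.

Lemma forestsE s k : ((k + s)%:R * (forests s k)%:R = k%:R * (k + s)%:R ^+ s :> int)%R.
Proof. by rewrite -natrM forests_mul natrM natrX. Qed.

Lemma natr_inj_int (m n : nat) : (m%:R = n%:R :> int)%R -> m = n.
Proof. lia. Qed.

Lemma forests1E s k : 0 < k ->
  ((k + s).+1%:R * (forests1 s k)%:R =
   ((k - 1)%:R * (k + s).+1%:R + s%:R) * (k + s).+1%:R ^+ s :> int)%R.
Proof.
case: k => // k _; rewrite /forests1 natrD !natrM !natrX subn1 /=.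
by case: s => [|s] /=; [rewrite !expr0; ring | rewrite exprS; ring].
Qed.

(** Remove one of the [k.+1] roots; its [l] children become roots. *)
Lemma forestsS s k :
  forests s k.+1 = \sum_(l < s.+1) 'C(s, l) * forests (s - l) (k + l).
Proof.
case: s => [|s]; first by rewrite big_ord1.
apply/esym/natr_inj_int.
apply: (@sum_bin_affine_eq _ (k + s.+1) k%:R 1
  (fun l => forests (s.+1 - l) (k + l))) => [|l ls|]; first by lia.
  have := forestsE (s.+1 - l) (k + l).
  by rewrite (_ : k + l + (s.+1 - l) = k + s.+1) => [->|]; [rewrite mul1r natrD|lia].
rewrite /= addSn natrM natrX exprS -[(k + s.+1).+1%:R%R]natr1 -[k.+1%:R%R]natr1.
set u := ((_ + 1) ^+ s)%R; rewrite natrD -[s.+1%:R%R]natr1; ring.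
Qed.

(** The root removed is the distinguished one: its [l] children avoid [b], which then remains as an
    unconstrained nonroot. *)
Lemma forests1S s k :
  forests1 s k.+1 = \sum_(l < s.+1) 'C(s, l) * forests (s - l).+1 (k + l).
Proof.
apply/esym/natr_inj_int.
apply: (@sum_bin_affine_eq _ (k + s).+1 (k%:R * (k + s).+1%:R) (k + s).+1%:R
  (fun l => forests (s - l).+1 (k + l))) => // [l ls|].
  rewrite /= (_ : k + l + (s - l).+1 = (k + s).+1); last by lia.
  by rewrite natrM natrX [in LHS]natrD mulrA; congr (_ * _)%R; ring.
have := forests1E s (ltn0Sn k); rewrite addSn subSS subn0.
rewrite (_ : (k + s).+2%:R = (k + s).+1%:R + 1 :> int)%R; last by rewrite natr1.
move=> E; rewrite -[RHS]mulrA E; move: ((k + s).+1%:R)%R => t; rewrite mulrA; congr (_ * _)%R; ring.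
Qed.

(** The second summand counts the forests in which [b] is a child of [a]: cutting that edge makes
    [b] a root. *)
Lemma forests1_compl s k :
  forests1 s k + (if 0 < k then forests s k.+1 else 0) = forests s.+1 k.
Proof.
case: k => [|k] //; rewrite ltn0Sn.
apply/natr_inj_int.
have T0 : ((k + s).+2%:R != 0 :> int)%R by lia.
apply: (mulfI T0); rewrite natrD mulrDr.
have := forests1E s (ltn0Sn k); rewrite addSn subSS subn0 => ->.
have := forestsE s k.+2; rewrite !addSn => ->.
rewrite /forests addSn addnS natrM natrX -[k.+2%:R%R]natr1 -[k.+1%:R%R]natr1.
have : ((k + s).+2%:R = k%:R + s%:R + 2 :> int)%R by rewrite -!natr1 natrD; ring.
move: ((k + s).+2%:R)%R => t Et; move: (t ^+ s)%R => u; rewrite Et; ring.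
Qed.

(** Remove a root. Of the two special vertices, its children contain neither, one (which becomes the
    distinguished root, in two ways), or both (and no constraint remains). *)
Lemma forests2S s k :
  forests2 s k.+1 = \sum_(l < s.+1) 'C(s, l) *
    (forests2 (s - l) (k + l) + (forests1 (s - l) (k + l).+1).*2 + forests (s - l) (k + l).+2).
Proof.
apply/esym/natr_inj_int.
pose T := (k + s).+2.
have ET : (T%:R = k%:R + s%:R + 2 :> int)%R by rewrite /T -!natr1 natrD; ring.
apply: (@sum_bin_affine_eq _ T (k%:R * T%:R ^+ 2 + 2 * s%:R + k%:R + 2) (T%:R ^+ 2 - 1)
  (fun l => forests2 (s - l) (k + l) + (forests1 (s - l) (k + l).+1).*2
     + forests (s - l) (k + l).+2)) => // [l ls|].
  rewrite !natrD -addnn natrD !mulrDr.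
  have := forests1E (s - l) (ltn0Sn (k + l)).
  rewrite (_ : ((k + l).+1 + (s - l)).+1 = T) => [->|]; last by lia.
  have := forestsE (s - l) (k + l).+2.
  rewrite (_ : (k + l).+2 + (s - l) = T) => [->|]; last by lia.
  rewrite /forests2 (_ : k + l + (s - l) = k + s); last by lia.
  rewrite -/T !natrM natrX subSS subn0 natrB //.
  rewrite -[(k + l).+2%:R%R]natr1 -[(k + l).+1%:R%R]natr1 !natrD.
  clearbody T; move: (T%:R ^+ (s - l))%R => u; rewrite ET; ring.
rewrite /forests2 !addSn -/T natrM natrX natrM -[T.+1%:R%R]natr1.
move: ((T%:R + 1) ^+ s)%R => u.
rewrite -[k.+1%:R%R]natr1 -[(k + s).+1%:R%R]natr1 natrD.
clearbody T; rewrite ET; ring.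
Qed.

(** With [s = n - 2], [l] counts the labels other than [1] and [n] in the set [W] of the root and
    its children. The summands are the cases where [W] contains neither [1] nor [n], only [1], or
    only [n]. *)
Lemma forest_total s : 0 < s ->
  \sum_(l < s.+1) 'C(s, l) *
    (forests2 (s - l) l.-1 + forests1 (s - l) l + forests (s - l).+1 l) =
  s.+1 ^ s.-1 * s ^ 2.
Proof.
move=> s0; apply/natr_inj_int.
pose t : int := (s%:R + 1)%R.
have Et : (s.+1%:R = t)%R by rewrite -natr1.
have t0 : (t != 0)%R by rewrite /t; lia.
have t1 : (t + 1 != 0)%R by rewrite /t; lia.
(* These coefficients make the whole affine sum vanish. They describe the summands for positive [l]
   only, [l.-1] being truncated at [0]; so, up to the factor [t], the wanted sum is minus the affine
   term at [l = 0]. *)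
have := sum_bin_affine s s.+1 (- (s%:R * s%:R))%R (t ^+ 2 - 1)%R.
rewrite Et [X in _ = X](_ : _ = 0)%R; last by rewrite /t; ring.
move/eqP; rewrite mulf_eq0 (negbTE t1) /= big_ord_recl bin0 subn0 mulr0 addr0 mul1r.
rewrite addrC addr_eq0 => /eqP E.
rewrite big_ord_recl [X in X + _](_ : _ = 0) ?add0n ?natr_sum; last by rewrite muln0.
apply: (mulfI t0).
rewrite mulr_sumr natrM !natrX Et.
rewrite [RHS](_ : _ = - (- (s%:R * s%:R) * t ^+ s))%R; last first.
  have -> : (t ^+ s = t * t ^+ s.-1)%R by rewrite -exprS prednK.
  by move: (t ^+ s.-1)%R => u; ring.
rewrite -E; apply: eq_bigr => l _.
rewrite natrM mulrCA; congr (_ * _)%R.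
rewrite lift0 natrD natrD mulrDr mulrDr.
have ls : l.+1 <= s by [].
have := forests1E (s - l.+1) (ltn0Sn l).
rewrite (_ : l.+1 + (s - l.+1) = s); last by lia.
rewrite Et => ->.
rewrite /forests2 /= (_ : (l + (s - l.+1)).+2 = s.+1); last by lia.
rewrite (_ : l.+1 + (s - l.+1).+1 = s.+1); last by lia.
rewrite (_ : l + (s - l.+1) = s - 1); last by lia.
rewrite subSS subn0 !natrM !natrX Et !natrB // -[l.+1%:R%R]natr1.
move: (t ^+ _)%R => u; rewrite /t; ring.
Qed.

End ForestNumbers.

Arguments forests : simpl never.
Arguments forests1 : simpl never.
Arguments forests2 : simpl never.

(** * Functions split by a fibre *)

Lemma sum_subset_card (T : finType) (S : {set T}) (F : nat -> nat) :
  \sum_(L : {set T} | L \subset S) F #|L| = \sum_(l < #|S|.+1) 'C(#|S|, l) * F l.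
Proof.
rewrite (partition_big (fun L : {set T} => inord #|L| : 'I_#|S|.+1) xpredT) //=.
apply: eq_bigr => l _.
rewrite (eq_bigl (fun L => L \in [set L : {set T} | (L \subset S) & (#|L| == l)])); last first.
  move=> L; rewrite !inE; case: (boolP (L \subset S)) => //= sLS.
  by rewrite -val_eqE /= inordK // ltnS subset_leq_card.
rewrite -cards_draws -sum_nat_const.
by apply: eq_bigr => L; rewrite inE => /andP[_ /eqP->].
Qed.

Section Layers.
Variables (T X : finType).
Implicit Types (S L : {set T}) (R : {set X}) (f : {ffun T -> X}).

(** The dummy value [d] off [S] represents each function on [S] exactly once in a fixed type, so
    that [S] can shrink in a recursion. *)
Definition maps_to (d : X) S R : {set {ffun T -> X}} :=
  [set f : {ffun T -> X} | [forall i, if i \in S then f i \in R else f i == d]].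

Definition assign L (v : X) f : {ffun T -> X} :=
  [ffun i => if i \in L then v else f i].

Lemma assign_out L v f i : i \notin L -> assign L v f i = f i.
Proof. by move=> iL; rewrite ffunE (negbTE iL). Qed.

Lemma assign_in L v f i : i \in L -> assign L v f i = v.
Proof. by move=> iL; rewrite ffunE iL. Qed.

Lemma maps_toP d S R f :
  reflect ((forall i, i \in S -> f i \in R) /\ (forall i, i \notin S -> f i = d))
          (f \in maps_to d S R).
Proof.
rewrite inE; apply: (iffP forallP) => [H|[H1 H2] i].
  by split=> i Hi; have := H i; rewrite ?Hi ?(negbTE Hi) // => /eqP.
by case: ifPn => [/H1|/H2->].
Qed.

(** Cutting out the fibre [L] over [v] leaves a function on [S :\: L] that avoids [v]; [assign L v]
    restores the original and [assign L d] inverts it. *)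
Lemma card_maps_to_layers d S R v (Phi : pred {ffun T -> X}) : v \in R ->
  #|[set f in maps_to d S R | Phi f]| =
  \sum_(L : {set T} | L \subset S)
     #|[set f in maps_to d (S :\: L) (R :\ v) | Phi (assign L v f)]|.
Proof.
move=> vR; rewrite -sum1_card.
rewrite (partition_big (fun f : {ffun T -> X} => [set i in S | f i == v])
           (fun L : {set T} => L \subset S)) /=; last first.
  by move=> f _; apply/subsetP=> i; rewrite inE => /andP[].
apply: eq_bigr => L => sLS.
rewrite -sum1_card.
rewrite (reindex_onto (assign L v) (assign L d)) /=; last first.
  move=> f; rewrite inE => /andP[_ /eqP defL].
  apply/ffunP=> i; rewrite !ffunE; case: ifPn => iL; last by rewrite (negbTE iL).
  by move: iL; rewrite -defL inE => /andP[_ /eqP].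
apply: eq_bigl => f; rewrite [in LHS]inE [in RHS]inE.
case: (Phi _); rewrite ?andbT ?andbF //=.
apply/idP/idP.
  case/andP=> /andP[/maps_toP[H1 H2] /eqP defL] /eqP eqf.
  apply/maps_toP; split=> i; rewrite !inE.
    case/andP=> iL iS; have := H1 _ iS; rewrite ffunE (negbTE iL) => ->.
    rewrite andbT; apply/eqP=> fv; case/negP: (iL).
    have : i \in [set i in S | assign L v f i == v] by rewrite inE iS assign_out //= fv eqxx.
    by rewrite defL.
  rewrite negb_and negbK -eqf; case: (boolP (i \in L)) => /= [iL _|iL iS].
    by rewrite !ffunE iL.
  by have := H2 _ iS; rewrite !ffunE (negbTE iL).
case/maps_toP=> H1 H2; apply/andP; split; first (apply/andP; split).
- apply/maps_toP; split=> i Hi; rewrite ffunE; case: ifPn => // iL.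
    by have := H1 i; rewrite !inE Hi iL => /(_ isT)/andP[].
    by have := subsetP sLS _ iL; rewrite (negbTE Hi).
  by apply: H2; rewrite !inE (negbTE Hi) andbF.
- apply/eqP/setP=> i; rewrite inE ffunE; case: (boolP (i \in L)) => iL.
    by rewrite eqxx (subsetP sLS).
  apply/negP=> /andP[iS fv]; have := H1 i; rewrite !inE iL iS fv => /(_ isT).
  by [].
- apply/eqP/ffunP=> i; case: (boolP (i \in L)) => iL; last by rewrite !assign_out.
  by rewrite assign_in // H2 // inE iL.
Qed.

End Layers.

(** * Forests as parent functions *)

Lemma sum_subsetD1 (T : finType) (S : {set T}) (b : T) (G : {set T} -> nat) :
  b \in S ->
  \sum_(L : {set T} | L \subset S) G L =
  \sum_(L : {set T} | L \subset S :\ b) (G L + G (b |: L)).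
Proof.
move=> bS; rewrite big_split /= (bigID (fun L : {set T} => b \in L)) /= addnC.
congr (_ + _).
  by apply: eq_bigl => L; rewrite subsetD1.
rewrite (reindex_onto (fun L => b |: L) (fun L => L :\ b)) /=; last first.
  by move=> L /andP[_ bL]; rewrite setD1K.
apply: eq_bigl => L; rewrite !inE eqxx andbT subUset sub1set bS /= subsetD1; congr (_ && _).
by apply/eqP/idP => [<-|bL]; rewrite ?setD11 ?setU1K.
Qed.

Lemma sum_subsetD2 (T : finType) (S : {set T}) (a b : T) (G : {set T} -> nat) :
  a \in S -> b \in S -> a != b ->
  \sum_(L : {set T} | L \subset S) G L =
  \sum_(L : {set T} | L \subset S :\ a :\ b)
     (G L + G (b |: L) + (G (a |: L) + G (a |: (b |: L)))).
Proof.
move=> aS bS ab; rewrite (sum_subsetD1 _ aS) (@sum_subsetD1 _ _ b) //.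
  by apply: eq_bigr => L _; lia.
by rewrite !inE eq_sym ab.
Qed.

Section Forests.
Variable T : finType.
Implicit Types (S K L A : {set T}) (f : {ffun T -> T}).

(* With values of [f] in [K :|: S], this says that every orbit leaves [S],
   i.e., that [f] is the parent function of a forest with root set [K]. *)
Definition acyclic S f :=
  [forall A : {set T}, (A \subset S) ==> (A != set0) ==> [exists i in A, f i \notin A]].

Lemma acyclicP S f :
  reflect (forall A, A \subset S -> A != set0 -> exists2 i, i \in A & f i \notin A)
          (acyclic S f).
Proof.
apply: (iffP forallP) => [H A sAS A0|H A].
  by have := H A; rewrite sAS A0 /= => /exists_inP.
by apply/implyP=> sAS; apply/implyP=> A0; apply/exists_inP; apply: H.
Qed.

(** Arguments in [L] leave [S] in one step, so only sets that avoid [L] can trap an orbit. *)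
Lemma acyclic_assign S L v f : v \notin S -> L \subset S ->
  acyclic S (assign L v f) = acyclic (S :\: L) f.
Proof.
move=> vS sLS; apply/acyclicP/acyclicP => H A sA A0.
  have [|i iA fi] := H A _ A0; first by apply: subset_trans sA (subsetDl _ _).
  exists i => //; move: fi; rewrite assign_out //.
  by have := subsetP sA _ iA; rewrite inE => /andP[].
case: (set_0Vmem (A :&: L)) => [AL0|[i]]; last first.
  rewrite inE => /andP[iA iL]; exists i => //; rewrite assign_in //.
  by apply: contra vS; apply: (subsetP sA).
have [|i iA fi] := H A _ A0.
  by rewrite subsetD sA -setI_eq0 AL0 eqxx.
exists i => //; rewrite assign_out //; apply/negP=> iL.
by have := in_set0 i; rewrite -AL0 inE iA iL.
Qed.

Lemma acyclic_no_root S f d : f \in maps_to d S S -> acyclic S f -> S = set0.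
Proof.
case/maps_toP=> fS _ /acyclicP H; apply/eqP/negPn/negP => S0.
by have [i iS] := H S (subxx _) S0; rewrite fS.
Qed.

(** Once the children [L] of [v] are known, [v] is no longer a possible parent and [L] moves from
    the nonroots to the roots. *)
Lemma layer_range S K L v : v \in K -> [disjoint K & S] -> L \subset S ->
  (K :|: S) :\ v = (K :\ v :|: L) :|: (S :\: L).
Proof.
move=> vK dKS sLS; apply/setP=> x; rewrite !inE.
have [->|xv] := eqVneq x v.
  have vS := disjointFr dKS vK; rewrite vS andbF /= orbF.
  by apply/esym/negP => /(subsetP sLS); rewrite vS.
by case: (boolP (x \in L)) => //= xL; rewrite ?orbT ?orbF ?(subsetP sLS x xL) ?orbT.
Qed.

Lemma layer_disjoint S K L v : [disjoint K & S] -> L \subset S ->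
  [disjoint K :\ v :|: L & S :\: L].
Proof.
move=> dKS sLS; apply/pred0P=> x /=; rewrite !inE.
case: (boolP (x \in L)) => //= xL; rewrite ?andbF ?orbF //.
case: (boolP (x \in K)) => xK; rewrite ?andbF //.
by rewrite (disjointFr dKS xK) andbF.
Qed.

Lemma layer_card S K L v : v \in K -> [disjoint K & S] -> L \subset S ->
  #|K :\ v :|: L| = #|K|.-1 + #|L|.
Proof.
move=> vK dKS sLS; rewrite cardsU (cardsD1 v K) vK (_ : _ :&: L = set0) ?cards0 ?subn0 //.
apply/setP=> x; rewrite !inE; apply/negP => /andP[/andP[_ xK] xL].
by have := disjointFr dKS xK; rewrite (subsetP sLS).
Qed.

Lemma card_layer_compl S L : L \subset S -> #|S :\: L| = #|S| - #|L|.
Proof. by move=> sLS; rewrite cardsD (setIidPr sLS). Qed.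

(** Processing a root [v] lowers the number of vertices by one and yields the recursion
    [forestsS]. *)
Lemma card_forests d S K : [disjoint K & S] ->
  #|[set f in maps_to d S (K :|: S) | acyclic S f]| = forests #|S| #|K|.
Proof.
have [n] := ubnP (#|K| + #|S|); elim: n S K => // n IH S K ltn dKS.
case: (set_0Vmem K) => [->|[v vK]].
  rewrite set0U cards0; have [->|S0] := eqVneq S set0.
    rewrite cards0 /=; apply/eqP/cards1P; exists [ffun=> d].
    apply/setP=> f; rewrite in_set in_set1; apply/andP/eqP => [[/maps_toP[_ H] _]|->].
      by apply/ffunP=> i; rewrite ffunE H ?in_set0.
    split; first by apply/maps_toP; split=> i; rewrite ?in_set0 ?ffunE.
    by apply/acyclicP=> A; rewrite subset0 => ->.
  rewrite (_ : [set f in _ | _] = set0); last first.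
    apply/setP=> f; rewrite in_set in_set0; apply/negP => /andP[/acyclic_no_root H /H].
    by apply/eqP.
  by rewrite cards0 -(prednK (_ : 0 < #|S|)) // card_gt0.
have k0 : 0 < #|K| by rewrite card_gt0; apply/set0Pn; exists v.
rewrite (card_maps_to_layers d S _ (v := v)) ?inE ?vK //.
transitivity (\sum_(L : {set T} | L \subset S) forests (#|S| - #|L|) (#|K|.-1 + #|L|)).
  apply: eq_bigr => L => sLS.
  rewrite (layer_range vK dKS sLS) -(layer_card vK dKS sLS) -(card_layer_compl sLS).
  rewrite -IH; last exact: layer_disjoint.
    apply: eq_card => f; rewrite !in_set acyclic_assign //.
    by rewrite (disjointFr dKS vK).
  rewrite (layer_card vK dKS sLS) (card_layer_compl sLS).
  have := subset_leq_card sLS; lia.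
by rewrite (sum_subset_card S (fun l => forests (#|S| - l) (#|K|.-1 + l))) -forestsS prednK.
Qed.

Lemma card_forests_layers d S K v (Phi : pred {ffun T -> T}) :
  v \in K -> [disjoint K & S] ->
  #|[set f in maps_to d S (K :|: S) | acyclic S f && Phi f]| =
  \sum_(L : {set T} | L \subset S)
    #|[set f in maps_to d (S :\: L) ((K :\ v :|: L) :|: (S :\: L)) |
        acyclic (S :\: L) f && Phi (assign L v f)]|.
Proof.
move=> vK dKS; rewrite (card_maps_to_layers d S _ (v := v)) ?inE ?vK //.
apply: eq_bigr => L => sLS; rewrite (layer_range vK dKS sLS).
by apply: eq_card => f; rewrite !in_set acyclic_assign // (disjointFr dKS vK).
Qed.

(** Process [a] itself: its children must omit [b], and afterwards [a] has left the range, so that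
    [f b != a] is automatic. *)
Lemma card_forests1 d S K a b : [disjoint K & S] -> a \in K -> b \in S ->
  #|[set f in maps_to d S (K :|: S) | acyclic S f && (f b != a)]| =
  forests1 #|S :\ b| #|K|.
Proof.
move=> dKS aK bS; rewrite (card_forests_layers d _ aK dKS) (sum_subsetD1 _ bS).
have k0 : 0 < #|K| by rewrite card_gt0; apply/set0Pn; exists a.
rewrite -(prednK k0) forests1S.
rewrite -(sum_subset_card _ (fun l => forests (#|S :\ b| - l).+1 (#|K|.-1 + l))).
apply: eq_bigr => L; rewrite subsetD1 => /andP[sLS bL].
rewrite [X in _ + X](_ : _ = 0) ?addn0; last first.
  apply/eqP; rewrite cards_eq0; apply/eqP/setP=> f.
  by rewrite in_set in_set0 assign_in ?setU11 // eqxx !andbF.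
have -> : (#|S :\ b| - #|L|).+1 = #|S :\: L|.
  rewrite (card_layer_compl sLS) (cardsD1 b S) bS.
  by have := subset_leq_card (_ : L \subset S :\ b); rewrite subsetD1 sLS bL; lia.
rewrite -(layer_card aK dKS sLS) -(card_forests d); last exact: layer_disjoint.
apply: eq_card => f; rewrite in_set [in RHS]in_set assign_out //.
case: (boolP (f \in _)) => //= /maps_toP[fR _].
case: (acyclic _ _) => //=.
have /fR : b \in S :\: L by rewrite inE bL.
rewrite -(layer_range aK dKS sLS) in_setD1; by case/andP.
Qed.

(** Process any root [v]; whether [a] and [b] lie in its set [L] of children gives the four terms of
    [forests2S]. *)
Lemma card_forests2 d S K a b : [disjoint K & S] -> a \in S -> b \in S -> a != b ->
  #|[set f in maps_to d S (K :|: S) | acyclic S f && ((f a != b) && (f b != a))]| =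
  forests2 #|S :\ a :\ b| #|K|.
Proof.
have [n] := ubnP (#|K| + #|S|); elim: n S K => // n IH S K ltn dKS aS bS ab.
case: (set_0Vmem K) => [->|[v vK]].
  rewrite set0U cards0 /forests2 !mul0n; apply/eqP; rewrite cards_eq0.
  apply/eqP/setP=> f; rewrite in_set in_set0; apply/negP.
  case/and3P=> /acyclic_no_root H /H S0.
  by rewrite S0 in_set0 in aS.
have k0 : 0 < #|K| by rewrite card_gt0; apply/set0Pn; exists v.
have vS : v \in S = false by rewrite (disjointFr dKS vK).
have va : v != a by apply: contraTneq aS => <-; rewrite vS.
have vb : v != b by apply: contraTneq bS => <-; rewrite vS.
rewrite (card_forests_layers d _ vK dKS) (sum_subsetD2 _ aS bS ab).
set s := #|S :\ a :\ b|.
have Es : #|S| = s.+2.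
  by rewrite (cardsD1 a) aS (cardsD1 b (S :\ a)) !inE eq_sym ab bS.
rewrite -(prednK k0) forests2S; set k := #|K|.-1.
rewrite -(sum_subset_card _ (fun l => forests2 (s - l) (k + l) +
   (forests1 (s - l) (k + l).+1).*2 + forests (s - l) (k + l).+2)).
apply: eq_bigr => L sL.
have Ls := subset_leq_card sL; rewrite -/s in Ls.
move: sL; rewrite !subsetD1 => /andP[/andP[sLS aL] bL].
have saLS : a |: L \subset S by rewrite subUset sub1set aS.
have sbLS : b |: L \subset S by rewrite subUset sub1set bS.
have sabLS : a |: (b |: L) \subset S by rewrite subUset sub1set aS.
have cb : #|b |: L| = #|L|.+1 by rewrite cardsU1 bL.
have ca : #|a |: L| = #|L|.+1 by rewrite cardsU1 aL.
have abL : a \notin b |: L by rewrite !inE negb_or ab.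
have baL : b \notin a |: L by rewrite !inE negb_or eq_sym ab.
have cab : #|a |: (b |: L)| = #|L|.+2 by rewrite cardsU1 abL cb.
have lc (M : {set T}) (sM : M \subset S) := layer_card vK dKS sM.
have ld (M : {set T}) (sM : M \subset S) := layer_disjoint v dKS sM.
rewrite -addnn addnA [in RHS]addnA; congr (_ + _ + _ + _).
- transitivity (#|[set f in maps_to d (S :\: L) ((K :\ v :|: L) :|: (S :\: L)) |
      acyclic (S :\: L) f && ((f a != b) && (f b != a))]|).
    by apply: eq_card => f; rewrite !in_set !assign_out.
  rewrite IH ?ld ?lc ?in_setD ?aL ?bL //; last first.
    rewrite (card_layer_compl sLS) -addnA subnKC ?(subset_leq_card sLS) //.
    by rewrite -ltnS -addSn prednK.
  congr forests2.
  have := card_layer_compl sLS; rewrite Es (cardsD1 a) in_setD aL aS.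
  rewrite (cardsD1 b (S :\: L :\ a)).
  rewrite !in_setD1 in_setD bL bS eq_sym ab.
  rewrite andbT !add1n.
  by rewrite !subSn ?(leqW Ls) // => -[].
(* The parent of [b] is [v], which is not [a]; only [f a != b] remains, with [b] as the
   distinguished root. *)
- transitivity (#|[set f in maps_to d (S :\: (b |: L))
        ((K :\ v :|: (b |: L)) :|: (S :\: (b |: L))) |
      acyclic (S :\: (b |: L)) f && (f a != b)]|).
    apply: eq_card => f.
    by rewrite !in_set assign_out // assign_in ?setU11 // va andbT.
  rewrite card_forests1 ?ld ?lc ?in_setD ?abL // ?cb ?addnS; last first.
    by rewrite in_setU setU11 orbT.
  congr forests1; have := card_layer_compl sbLS.
  by rewrite Es cb (cardsD1 a) in_setD abL aS /= add1n subSS subSn // => -[].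
- transitivity (#|[set f in maps_to d (S :\: (a |: L))
        ((K :\ v :|: (a |: L)) :|: (S :\: (a |: L))) |
      acyclic (S :\: (a |: L)) f && (f b != a)]|).
    apply: eq_card => f.
    by rewrite !in_set [assign _ _ f b]assign_out // assign_in ?setU11 // vb.
  rewrite card_forests1 ?ld ?lc ?in_setD ?baL // ?ca ?addnS; last first.
    by rewrite in_setU setU11 orbT.
  congr forests1; have := card_layer_compl saLS.
  by rewrite Es ca (cardsD1 b) in_setD baL bS /= add1n subSS subSn // => -[].
transitivity (#|[set f in maps_to d (S :\: (a |: (b |: L)))
        ((K :\ v :|: (a |: (b |: L))) :|: (S :\: (a |: (b |: L)))) |
      acyclic (S :\: (a |: (b |: L))) f]|).
  apply: eq_card => f.
  by rewrite in_set [in RHS]in_set !assign_in ?in_setU1 ?eqxx ?orbT // va vb !andbT.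
rewrite card_forests ?ld // lc // cab (card_layer_compl sabLS) cab Es !addnS.
by rewrite !subSS.
Qed.
End Forests.

(** * Trees as parent functions *)

Lemma set2_eqP (T : finType) (x y z w : T) :
  reflect ((x = z /\ y = w) \/ (x = w /\ y = z)) ([set x; y] == [set z; w]).
Proof.
apply: (iffP eqP) => [E|[[-> ->]|[-> ->]]] //; last by rewrite setUC.
have: x \in [set z; w] by rewrite -E set21.
have: y \in [set z; w] by rewrite -E set22.
have: z \in [set x; y] by rewrite E set21.
have: w \in [set x; y] by rewrite E set22.
by do 4 (case/set2P=> ?; subst); auto.
Qed.

Section ParentFunctions.
Variables (T : finType) (r : T).
Implicit Types (f g : {ffun T -> T}) (E : {set {set T}}).

Definition parent_edges f : {set {set T}} := [set [set x; f x] | x in [set~ r]].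

Lemma adj_parent_edges f x y :
  adj (parent_edges f) x y =
  (x != r) && (f x == y) || (y != r) && (f y == x).
Proof.
rewrite /adj; apply/imsetP/orP => [[z]|[]/andP[xr /eqP fx]].
- rewrite !inE => zr /eqP/set2_eqP[[-> ->]|[-> ->]]; rewrite zr eqxx; auto.
- by exists x; rewrite ?inE // fx.
- by exists y; rewrite ?inE // fx setUC.
Qed.

Lemma acyclic_neq f x : acyclic [set~ r] f -> x != r -> f x != x.
Proof.
move=> /acyclicP H xr; have [||i] := H [set x].
- by rewrite sub1set !inE.
- by apply/set0Pn; exists x; rewrite inE.
- by rewrite inE => /eqP->; rewrite inE.
Qed.

Lemma adj_sym E x y : adj E x y = adj E y x.
Proof. by rewrite /adj setUC. Qed.

(** The vertices not connected to [r] form a set that avoids [r] and is closed under [f], so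
    acyclicity makes it empty. *)
Lemma parent_edges_connect f x : acyclic [set~ r] f ->
  connect (adj (parent_edges f)) x r.
Proof.
move=> /acyclicP H; apply/negPn/negP => nx.
have [||i] := H [set y | ~~ connect (adj (parent_edges f)) y r].
- apply/subsetP=> y; rewrite !inE; apply: contra => /eqP->; exact: connect0.
- by apply/set0Pn; exists x; rewrite inE.
rewrite !inE negbK => ni fi; case/negP: (ni).
apply: connect_trans fi; apply: connect1; rewrite adj_parent_edges.
by rewrite eqxx andbT; apply/orP; left; apply: contra ni => /eqP->; apply: connect0.
Qed.

(** If a vertex of the cycle is not the parent of another one, both its neighbours in the cycle are
    its parent and hence coincide. Otherwise [f] maps the cycle onto itself, against acyclicity. *)
Lemma parent_edges_no_cycle f (c : seq T) : acyclic [set~ r] f -> 2 < size c ->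
  ~ ucycle (adj (parent_edges f)) c.
Proof.
move=> acf sc /andP[cyc uc].
pose A := [set x in c].
case: (pickP [pred x in c | x \notin f @: (A :\ r)]) => [x /andP[/= xc leaf]|onto].
  have parent y : y \in c -> adj (parent_edges f) x y -> f x = y.
    move=> yc; rewrite adj_parent_edges => /orP[/andP[_ /eqP]//|/andP[yr /eqP fy]].
    by case/imsetP: leaf; exists y; rewrite ?inE ?yr.
  have [i s defc] := rot_to xc.
  have memc y : y \in x :: s -> y \in c by rewrite -defc mem_rot.
  move: uc cyc sc; rewrite -(rot_uniq i) -(rot_cycle i) -(size_rot i) defc.
  case: s memc {defc} => [|y [|z s]] //= memc.
  case/and3P=> _ yzs _; rewrite rcons_path => /and4P[xy _ _ lx] _.
  have lc : last z s \in z :: s by apply: mem_last.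
  have := parent y; rewrite memc ?inE ?eqxx ?orbT // => /(_ isT xy) fxy.
  have lc' : last z s \in c by apply: memc; rewrite 2!in_cons lc !orbT.
  rewrite adj_sym in lx; have fxl := parent _ lc' lx.
  by rewrite -fxy fxl lc in yzs.
(* Comparing cardinalities excludes [r] from [A] and then gives [f @: A = A]. *)
have sub : A \subset f @: (A :\ r).
  by apply/subsetP=> x; rewrite inE => xc; have := onto x; rewrite /= xc => /negbFE.
have := subset_leq_card sub; have := leq_imset_card f (mem (A :\ r)).
rewrite [#|A|](cardsD1 r) => le1 le2.
have rA : r \notin A by apply/negP=> rA; move: (leq_trans le2 le1); rewrite rA ltnn.
have AE : A :\ r = A.
  apply/setP=> x; rewrite in_setD1; case: eqP => // ->.
  exact/esym/negbTE.
rewrite AE in sub le1.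
have /eqP EA : A == f @: A by rewrite eqEcard sub.
have [||i iA] := acyclicP _ _ acf A.
- by apply/subsetP=> x; rewrite in_setC1; apply: contraTneq => ->.
- case: c sc @A {sub le1 le2 rA AE EA uc cyc onto} => // x c _.
  by apply/set0Pn; exists x; rewrite inE mem_head.
by rewrite EA imset_f.
Qed.

Lemma parent_edges_tree f : acyclic [set~ r] f -> is_tree (parent_edges f).
Proof.
move=> acf; split.
- move=> e /imsetP[x]; rewrite !inE => xr ->.
  by rewrite cards2 eq_sym acyclic_neq.
- have sym : connect_sym (adj (parent_edges f)) by apply: sym_connect_sym; apply: adj_sym.
  move=> x y; apply: connect_trans (parent_edges_connect x acf) _.
  by rewrite sym parent_edges_connect.
- by move=> c sc; apply: parent_edges_no_cycle.
Qed.

(** If [f x != g x], the edge from [x] to [f x] must come from [g (f x) = x]. Since [f (f x) = x]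
    would be a cycle of [f], the functions differ at [f x] too; so the set where they differ traps
    the orbits of [f]. *)
Lemma parent_edges_inj f g :
  f \in maps_to r [set~ r] setT -> g \in maps_to r [set~ r] setT ->
  acyclic [set~ r] f -> parent_edges f = parent_edges g -> f = g.
Proof.
move=> /maps_toP[_ fr] /maps_toP[_ gr] acf Efg.
pose A := [set x | (x != r) && (f x != g x)].
have closed x : x \in A -> f x \in A.
  rewrite !inE => /andP[xr nfg].
  have : adj (parent_edges g) x (f x) by rewrite -Efg adj_parent_edges xr eqxx.
  rewrite adj_parent_edges xr eq_sym (negbTE nfg) /= => /andP[fxr /eqP gfx].
  rewrite fxr gfx /=; apply/eqP=> ffx.
  have [||i] := acyclicP _ _ acf [set x; f x].
  - by apply/subsetP=> y /set2P[]->; rewrite !inE.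
  - by apply/set0Pn; exists x; rewrite set21.
  by case/set2P=> ->; rewrite ?ffx ?set22 ?set21.
have A0 : A = set0.
  apply/eqP/negPn/negP=> A0; have [|i iA] := acyclicP _ _ acf A _ A0.
    by apply/subsetP=> x; rewrite !inE => /andP[].
  by rewrite closed.
apply/ffunP=> x; have := in_set0 x; rewrite -A0 inE.
have [->|xr /= /negbFE/eqP//] := eqVneq x r.
by rewrite fr ?gr // !inE eqxx.
Qed.

(** Each vertex points to a neighbour strictly nearer to [r], which gives acyclicity. The parent
    edges already connect everything, so a further edge of [E] would close a cycle. *)
Lemma tree_parent_edges E : is_tree E ->
  exists2 f, (f \in maps_to r [set~ r] setT) && acyclic [set~ r] f & E = parent_edges f.
Proof.
case=> E2 conn nocyc.
have dist_ex x : exists n, [exists p : n.-tuple T, path (adj E) x p && (last x p == r)].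
  have /connectP[p xp ->] := conn x r.
  by exists (size p); apply/existsP; exists (in_tuple p); rewrite xp eqxx.
pose dist x := ex_minn (dist_ex x).
have distP x : x != r -> [exists y, adj E x y && (dist y < dist x)].
  move=> xr; rewrite [dist x]/dist; case: ex_minnP => n /existsP[p /andP[xp lp]] _.
  case: n p xp lp => [|n] p; first by rewrite tuple0 /= (negbTE xr).
  case/tupleP: p => y p /= /andP[xy yp] lp.
  apply/existsP; exists y; rewrite xy /=.
  rewrite /dist; case: ex_minnP => m _ min_m; rewrite ltnS; apply: min_m.
  by apply/existsP; exists p; rewrite yp.
pose f := [ffun x => if x == r then r else odflt r [pick y | adj E x y && (dist y < dist x)]].
have fP x : x != r -> adj E x (f x) && (dist (f x) < dist x).
  move=> xr; rewrite ffunE (negbTE xr); case: pickP => [//|no].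
  by have /existsP[y] := distP x xr; rewrite no.
have acf : acyclic [set~ r] f.
  apply/acyclicP=> A sA /set0Pn[x xA].
  case: (arg_minnP dist xA) => i iA min_i; exists i => //.
  have /fP/andP[_ lt] : i != r by have := subsetP sA _ iA; rewrite !inE.
  by apply/negP=> /min_i; rewrite leqNgt lt.
have sub x y : adj (parent_edges f) x y -> adj E x y.
  rewrite adj_parent_edges => /orP[]/andP[zr /eqP<-].
    by have /andP[] := fP _ zr.
  by rewrite adj_sym; have /andP[] := fP _ zr.
exists f.
  rewrite acf andbT; apply/maps_toP; split=> i; rewrite ?inE // negbK => /eqP->.
  by rewrite ffunE eqxx.
apply/setP=> e; apply/idP/idP; last first.
  by case/imsetP=> x; rewrite !inE => /fP/andP[xf _] ->.
move=> eE; have /eqP/cards2P[x [y [xy defe]]] := E2 e eE; rewrite defe in eE *.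
apply/negPn/negP => nxy.
have [_ /(_ x y)/connectP[p0 xp0 lp0] _] := parent_edges_tree acf.
(* This simple path has at least two edges, since [x] and [y] are not joined by a parent edge; the
   edge of [E] closes it to a cycle on more than two vertices. *)
case: (shortenP xp0) lp0 => p xp up _ lp.
have xpE : path (adj E) x p by apply: sub_path xp.
apply: (nocyc (x :: p)).
  case: p lp xp {xpE up} => [/= yx|z [|//]]; first by rewrite yx eqxx in xy.
  by move=> /= <-; rewrite andbT /adj (negbTE nxy).
by rewrite /ucycle up andbT /= rcons_path xpE -lp adj_sym.
Qed.

End ParentFunctions.

(** * Uprooted trees *)

Lemma sum_max_split (n : nat) (H : {set 'I_n} -> nat) :
  \sum_(W | W != set0) H W =
  \sum_(r < n) \sum_(L : {set 'I_n} | L \subset [set v : 'I_n | v < r]) H (r |: L).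
Proof.
case: n H => [|n] H.
  rewrite big_ord0 big1 // => W /set0Pn[[]] //.
pose is_max (r : 'I_n.+1) (W : {set 'I_n.+1}) := (r \in W) && [forall v in W, v <= r].
(* The default [ord0] is reached only for the empty set. *)
pose mx W := odflt ord0 [pick r | is_max r W].
have mxE W r : W != set0 -> (mx W == r) = is_max r W.
  case/set0Pn=> x xW; rewrite /mx; case: pickP => [r' /andP[r'W /forall_inP r'max]|no] /=.
    apply/eqP/andP => [<-|[rW /forall_inP rmax]]; first by split=> //; apply/forall_inP.
    by apply/val_inj/anti_leq; rewrite rmax // r'max.
  case: (arg_maxnP (@nat_of_ord n.+1) xW) => i iW maxi; have := no i.
  by rewrite /is_max (iW : i \in W) /=; move/forall_inP; case.
rewrite (partition_big mx xpredT) //=; apply: eq_bigr => r _.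
rewrite (reindex_onto (fun L => r |: L) (fun W => W :\ r)) /=; last first.
  by move=> W /andP[W0]; rewrite mxE // => /andP[rW _]; rewrite setD1K.
apply: eq_bigl => L.
have W0 : r |: L != set0 by apply/set0Pn; exists r; rewrite setU11.
rewrite mxE // W0 /is_max setU11 /=; apply/andP/subsetP => [[/forall_inP rmax /eqP LE] v vL|sL].
  rewrite inE ltn_neqAle rmax ?inE ?vL ?orbT // andbT.
  by apply: contraTneq vL => /val_inj ->; rewrite -LE setD11.
have rL : r \notin L by apply/negP=> /sL; rewrite inE ltnn.
split; last by rewrite setU1K.
by apply/forall_inP=> v; rewrite !inE => /orP[/eqP->//|/sL]; rewrite inE => /ltnW.
Qed.

Section Uprooted.
Variables (n : nat) (a b : 'I_n).
Hypotheses (hn : 3 <= n) (ha : a = 0 :> nat) (hb : b = n.-1 :> nat).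

(** The range is split into roots and nonroots to fit the forest lemmas, with [r] as the only
    root. *)
Definition uprooted_fun (r : 'I_n) : {set {ffun 'I_n -> 'I_n}} :=
  [set f in maps_to r [set~ r] ([set r] :|: [set~ r]) | acyclic [set~ r] f &&
     ([forall v, (v != r) ==> (f v == r) ==> (v < r)] && ((f a != b) && (f b != a)))].

Let ab : a != b.
Proof. by rewrite -val_eqE /= ha hb; lia. Qed.

(* The number of trees of [uprooted_fun] whose root and children of the root
   form the set [W]. *)
Definition uprooted_weight (W : {set 'I_n}) : nat :=
  if a \in W then if b \in W then 0 else forests1 (n - #|W|).-1 #|W|.-1
  else if b \in W then forests (n - #|W|) #|W|.-1
  else forests2 (n - #|W|).-2 #|W|.-1.

(** The empty set has weight [0] and may be added. Sorting [W] by whether it contains [a] and [b]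
    leaves the sum of [forest_total] over subsets of the other [n - 2] labels. *)
Lemma sum_uprooted_weight :
  \sum_(W | W != set0) uprooted_weight W = (n - 1) ^ (n - 3) * (n - 2) ^ 2.
Proof.
have w0 : uprooted_weight set0 = 0 by rewrite /uprooted_weight !in_set0 cards0.
transitivity (\sum_(W : {set 'I_n} | W \subset [set: 'I_n]) uprooted_weight W).
  rewrite [RHS](bigD1 set0) ?sub0set //= w0 add0n.
  by apply: eq_bigl => W; rewrite subsetT.
rewrite (@sum_subsetD2 _ _ a b) ?inE //.
set S := _ :\ a :\ b.
have cS : #|S| = n - 2.
  have := cardsT 'I_n; rewrite card_ord (cardsD1 a [set: _]).
  rewrite (cardsD1 b ([set: _] :\ a)) !inE eq_sym ab -/S; lia.
transitivity (\sum_(L : {set 'I_n} | L \subset S) (forests2 (n - 2 - #|L|) #|L|.-1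
   + forests1 (n - 2 - #|L|) #|L| + forests (n - 2 - #|L|).+1 #|L|)).
  apply: eq_bigr => L => sL.
  have := subset_leq_card sL; rewrite cS => lL.
  move: sL; rewrite !subsetD1 => /andP[/andP[_ aL] bL].
  have abL : a \notin b |: L by rewrite !inE negb_or ab.
  have baL : b \notin a |: L by rewrite !inE negb_or eq_sym ab.
  rewrite /uprooted_weight !setU11 (negbTE aL) (negbTE bL) (negbTE abL) (negbTE baL).
  rewrite ![b \in a |: (b |: L)]in_setU1 !setU11 orbT addn0 !cardsU1 aL bL /= !add1n /=.
  rewrite addnAC; congr (_ + _ + _).
  - by congr forests2; rewrite -!subn1 -!subnDA; congr (_ - _); rewrite addnC.
  - by congr forests1; lia.
  - rewrite ?add0n; move: #|L| lL => l; clear -hn => lL; congr forests; lia.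
rewrite -cS (sum_subset_card S (fun l => forests2 (#|S| - l) l.-1
   + forests1 (#|S| - l) l + forests (#|S| - l).+1 l)) forest_total cS; last by lia.
by congr (_ ^ _ * _); lia.
Qed.

(** Without [r], the tree is a forest whose roots are the children [L] of [r]. *)
Lemma card_uprooted_layer (r : 'I_n) (L : {set 'I_n}) : L \subset [set v : 'I_n | v < r] ->
  #|[set f in maps_to r ([set~ r] :\: L) (([set r] :\ r :|: L) :|: ([set~ r] :\: L)) |
     acyclic ([set~ r] :\: L) f &&
     ((assign L r f a != b) && (assign L r f b != a))]| = uprooted_weight (r |: L).
Proof.
move=> sL; have rL : r \notin L by apply/negP => /(subsetP sL); rewrite inE ltnn.
rewrite setDv set0U; set S := [set~ r] :\: L.
have SE : S = ~: (r |: L) by apply/setP=> x; rewrite !inE negb_or andbC.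
have cS : #|S| = n - #|r |: L| by rewrite SE cardsCs setCK card_ord.
have cL : #|r |: L|.-1 = #|L| by rewrite cardsU1 rL.
have dLS : [disjoint L & S].
  by apply/pred0P=> x /=; rewrite !inE; case: (x \in L); rewrite ?andbF.
have [rb|rb] := eqVneq r b.
  (* If [b] is the root, the only condition is that [a] is not in [L]: afterwards [b] has left the
     range. *)
  subst r; rewrite /uprooted_weight in_setU1 setU11 (negbTE ab) /=.
  case: ifPn => aL.
    apply/eqP; rewrite cards_eq0; apply/eqP/setP=> f.
    by rewrite in_set in_set0 assign_in // eqxx !andbF.
  rewrite -cS cL -(card_forests b dLS); apply: eq_card => f.
  rewrite in_set [in RHS]in_set !assign_out //.
  case: (boolP (f \in _)) => //= /maps_toP[fR fd].
  case: (acyclic _ _) => //=.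
  rewrite [f b]fd ?inE ?eqxx ?andbF // eq_sym [b == a]eq_sym ab andbT eq_sym.
  have := fR a; rewrite !inE ab aL /= => /(_ isT).
  by apply: contraTneq => ->; rewrite eqxx (negbTE rL).
(* The label of [b] is the largest, so [b] is not below another root. *)
have bL : b \notin L.
  apply/negP=> /(subsetP sL); rewrite inE hb; have := ltn_ord r; lia.
have bS : b \in S by rewrite !inE eq_sym rb bL.
rewrite /uprooted_weight ![_ \in r |: L]in_setU1 (negbTE bL) [b == r]eq_sym (negbTE rb) /= -cS cL.
have [ar|ar] /= := eqVneq a r.
  (* No label is below that of [a], so a root [a] would have no children, although [b] still needs a
     parent; both sides are [0]. *)
  have L0 : L = set0.
    apply/setP=> x; rewrite in_set0; apply/negP=> /(subsetP sL); rewrite inE -ar ha; lia.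
  rewrite L0 cards0 set0U; apply/eqP; rewrite cards_eq0; apply/eqP/setP=> f.
  rewrite in_set in_set0; apply/negP => /and3P[/acyclic_no_root H /H S0 _].
  by rewrite S0 in_set0 in bS.
case: ifPn => aL.
  rewrite -[_.-1](_ : #|S :\ b| = _); last by rewrite (cardsD1 b S) bS.
  rewrite -(card_forests1 r dLS aL bS); apply: eq_card => f.
  rewrite !in_set assign_in // rb /= assign_out //.
have aS : a \in S by rewrite !inE ar aL.
rewrite -[_.-2](_ : #|S :\ a :\ b| = _); last first.
  by rewrite (cardsD1 a S) aS (cardsD1 b (S :\ a)) !inE eq_sym ab [b == r]eq_sym rb bL.
by rewrite -(card_forests2 r dLS aS bS ab); apply: eq_card => f; rewrite !in_set !assign_out.
Qed.

(** Sets [L] not below [r] contribute nothing. For the others the tree is uprooted, because vertices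
    outside [L] cannot have parent [r]. *)
Lemma card_uprooted_fun (r : 'I_n) :
  #|uprooted_fun r| =
  \sum_(L : {set 'I_n} | L \subset [set v : 'I_n | v < r]) uprooted_weight (r |: L).
Proof.
have dr : [disjoint [set r] & [set~ r]] by rewrite disjoints1 !inE eqxx.
rewrite /uprooted_fun (card_forests_layers r _ (set11 r) dr).
rewrite (bigID (fun L : {set 'I_n} => L \subset [set v : 'I_n | v < r])) /= [X in _ + X]big1 ?addn0.
  apply: eq_big => [L|L /andP[_ sL]].
    rewrite andbC; case: (boolP (L \subset [set v : 'I_n | v < r])) => //= sL.
    by apply/subsetP=> v /(subsetP sL); rewrite !inE; apply: contraTneq => ->; rewrite ltnn.
  rewrite -card_uprooted_layer //; apply: eq_card => f; rewrite in_set [in RHS]in_set.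
  case: (boolP (f \in _)) => //= /maps_toP[fR _]; congr (_ && _).
  rewrite (_ : [forall v, _] = true) //; apply/forallP=> v; apply/implyP=> vr.
  case: (boolP (v \in L)) => vL.
    by have := subsetP sL v vL; rewrite inE => ->; rewrite implybT.
  rewrite assign_out //; apply/implyP=> /eqP fv.
  have := fR v; rewrite !inE vr vL /= => /(_ isT); rewrite fv eqxx andbF /= orbF.
  by move=> /(subsetP sL); rewrite inE ltnn.
move=> L /andP[sLr nL]; apply/eqP; rewrite cards_eq0; apply/eqP/setP=> f.
rewrite in_set in_set0; apply/negP=> /and3P[_ _ /andP[/forallP H _]].
case/subsetP: nL => v vL; rewrite inE; have := H v; rewrite assign_in // eqxx /=.
by have := subsetP sLr _ vL; rewrite !inE => -> .
Qed.

Lemma has_card_uprooted' : has_card (@uprooted' n) ((n - 1) ^ (n - 3) * (n - 2) ^ 2).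
Proof.
pose U := [set t : 'I_n * {ffun 'I_n -> 'I_n} | t.2 \in uprooted_fun t.1].
have UP t : t \in U -> [/\ t.2 \in maps_to t.1 [set~ t.1] setT, acyclic [set~ t.1] t.2,
    forall v, v != t.1 -> t.2 v = t.1 -> v < t.1 & (t.2 a != b) && (t.2 b != a)].
  rewrite 2!in_set setUCr => /and4P[-> -> /forallP H -> ]; split=> // v vr fv.
  by have := H v; rewrite vr fv eqxx.
exists [seq (t.1, parent_edges t.1 t.2) | t <- enum U]; split.
- rewrite map_inj_in_uniq ?enum_uniq // => -[r f] [r' g]; rewrite !mem_enum.
  move=> /UP[/= fr acf _ _] /UP[/= gr acg _ _] [Er Efg]; subst r'.
  by rewrite (parent_edges_inj fr gr acf Efg).
- case=> r E; split.
    case/mapP=> -[r' f]; rewrite mem_enum => /UP[/= fr acf up nab] [-> ->].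
    move/maps_toP: fr => [_ fr]; split.
      split; first exact: parent_edges_tree.
      move=> v /=; rewrite adj_parent_edges eqxx /= => /andP[vr /eqP]; exact: up.
    move=> u v u0 vn; have -> : u = a by apply: val_inj; rewrite /= u0 ha.
    have -> : v = b by apply: val_inj; rewrite /= vn hb.
    by case/andP: nab => /negbTE n1 /negbTE n2; rewrite adj_parent_edges n1 n2 !andbF.
  case=> -[/= tE up] nab; have [f /andP[fr acf] defE] := tree_parent_edges r tE.
  apply/mapP; exists (r, f); rewrite /= -?defE // mem_enum 2!in_set setUCr fr acf /=.
  (* The dummy value at the root is no edge; if [a] or [b] is the root, the required inequality is
     just [a != b]. *)
  have frr : f r = r by move/maps_toP: fr => [_ ->] //; rewrite !inE eqxx.
  have := nab a b ha hb; rewrite defE adj_parent_edges negb_or => /andP[n1 n2].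
  apply/and3P; split.
  - apply/forallP=> v; apply/implyP=> vr; apply/implyP=> fv.
    by apply: up; rewrite defE adj_parent_edges vr fv orbT.
  - by move: n1; rewrite negb_and => /orP[/negPn/eqP ar|//]; rewrite ar frr -ar ab.
  - by move: n2; rewrite negb_and => /orP[/negPn/eqP br|//]; rewrite br frr -br eq_sym ab.
rewrite size_map -cardE -sum_uprooted_weight sum_max_split.
rewrite -sum1_card (eq_bigl (fun t => xpredT t.1 && (t.2 \in uprooted_fun t.1))); last first.
  by move=> t; rewrite in_set.
rewrite -(pair_big_dep xpredT (fun r f => f \in uprooted_fun r) (fun _ _ => 1)) /=.
by apply: eq_bigr => r _; rewrite sum1_card card_uprooted_fun.
Qed.

End Uprooted.

(** * Functions split by their levels *)

Section Levels.
Variables (T : finType) (B : nat).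
Implicit Types (S L : {set T}) (q : {ffun T -> 'I_B.+1}).

(* A partial function with values [< B]; the value [B] stands for undefined. *)
Definition levels m : {set 'I_B.+1} := [set v : 'I_B.+1 | m <= v < B].

Definition partials S m : {set {ffun T -> 'I_B.+1}} := maps_to ord_max S (levels m).

Definition below q m := #|[set i | q i < m]|.

(* [c] is the number of arguments that have already received a value [< m]. *)
Definition ample c m q := [forall m' : 'I_B.+1, (m < m') ==> (m' < below q m' + c)].

Definition roomy c q M := M.+2 < below q M.+1 + c.

Lemma ampleP c m q :
  reflect (forall m', m < m' -> m' <= B -> m' < below q m' + c) (ample c m q).
Proof.
apply: (iffP forallP) => [H m' mm' m'B|H m'].
  by have := H (Ordinal (m'B : m' < B.+1)); rewrite /= mm'.
by apply/implyP=> mm'; apply: H => //; rewrite -ltnS.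
Qed.

Lemma below_partial S m q : q \in partials S m -> m <= B -> below q m = 0.
Proof.
move=> /maps_toP[qS qd] mB; apply/eqP; rewrite cards_eq0; apply/eqP/setP=> i.
rewrite !inE; apply/negbTE; rewrite -leqNgt.
case: (boolP (i \in S)) => [/qS|/qd->//]; by rewrite inE => /andP[].
Qed.

Lemma below_assign S L (v : 'I_B.+1) m' q : L \subset S ->
  q \in partials (S :\: L) v.+1 -> v < m' -> m' <= B ->
  below (assign L v q) m' = #|L| + below q m'.
Proof.
move=> sLS /maps_toP[_ qd] vm mB; rewrite /below.
rewrite (_ : [set i | assign L v q i < m'] = L :|: [set i | q i < m']).
  rewrite cardsU (_ : L :&: _ = set0) ?cards0 ?subn0 //.
  apply/setP=> i; rewrite !inE; apply/negP => /andP[iL].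
  by rewrite qd ?inE ?iL //= ltnNge mB.
apply/setP=> i; rewrite !inE; case: (boolP (i \in L)) => iL.
  by rewrite assign_in.
by rewrite assign_out.
Qed.

(** At the threshold [v.+1] only [L] and the [c] earlier arguments count; at higher thresholds [L]
    merely joins the earlier ones. *)
Lemma ample_assign S L (v : 'I_B.+1) c q : v < B -> L \subset S ->
  q \in partials (S :\: L) v.+1 ->
  ample c v (assign L v q) = (v.+1 < c + #|L|) && ample (c + #|L|) v.+1 q.
Proof.
move=> vB sLS qP; apply/ampleP/andP => [H|[H1 /ampleP H2] m' vm mB].
  split.
    have := H v.+1 (leqnn _) vB.
    by rewrite (below_assign sLS qP) // (below_partial qP) // addn0 addnC.
  apply/ampleP=> m' vm mB; have := H m' (ltnW vm) mB.
  by rewrite (below_assign sLS qP) // ?(ltnW vm) // -addnA addnC -addnA.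
rewrite (below_assign sLS qP) //; case: (ltngtP v.+1 m') vm => // [vm _|<- _].
  by rewrite -addnA addnC -addnA; apply: H2.
by rewrite (below_partial qP) // addn0 addnC.
Qed.

Lemma roomy_assign S L (v : 'I_B.+1) c M q : L \subset S ->
  q \in partials (S :\: L) v.+1 -> v <= M -> M < B ->
  roomy c (assign L v q) M = roomy (c + #|L|) q M.
Proof.
move=> sLS qP vM MB; rewrite /roomy (below_assign sLS qP) //.
by congr (_ < _); lia.
Qed.

Lemma levelsD1 (v : 'I_B.+1) : levels v :\ v = levels v.+1.
Proof. by apply/setP=> x; rewrite !inE -val_eqE /= [v < x]ltn_neqAle eq_sym andbA. Qed.

Lemma card_ample_layers S (v : 'I_B.+1) c (Phi : pred {ffun T -> 'I_B.+1}) : v < B ->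
  #|[set q in partials S v | ample c v q && Phi q]| =
  \sum_(L : {set T} | L \subset S)
    (if v.+1 < c + #|L| then
       #|[set q in partials (S :\: L) v.+1 |
           ample (c + #|L|) v.+1 q && Phi (assign L v q)]|
     else 0).
Proof.
move=> vB; rewrite (card_maps_to_layers _ _ (v := v)) ?inE ?leqnn ?vB //.
apply: eq_bigr => L sLS; rewrite levelsD1; case: ifPn => [|/negbTE] cL.
  apply: eq_card => q; rewrite in_set [in RHS]in_set.
  by case: (boolP (q \in _)) => //= qP; rewrite (ample_assign _ vB sLS qP) cL.
apply/eqP; rewrite cards_eq0; apply/eqP/setP=> q; rewrite in_set in_set0.
by apply/negbTE/negP=> /and3P[qP]; rewrite (ample_assign _ vB sLS qP) cL.
Qed.

Lemma partial_empty m : partials set0 m = [set [ffun=> ord_max]].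
Proof.
apply/setP=> q; rewrite in_set1; apply/maps_toP/eqP => [[_ H]|->].
  by apply/ffunP=> i; rewrite ffunE H ?in_set0.
by split=> i; rewrite ?in_set0 ?ffunE.
Qed.

(** Reading one level is the recursion [forestsS], with the excess [c - m] as the number of
    roots. *)
Lemma card_ample S m c : m <= B -> m < c -> #|S| + c = B.+1 ->
  #|[set q in partials S m | ample c m q]| = forests #|S| (c - m).
Proof.
have [d] := ubnP (B - m); elim: d m c S => // d IH m c S dm mB mc Sc.
have [vB|Bm] := ltnP m B; last first.
  have m_eq : m = B by apply/eqP; rewrite eqn_leq mB.
  have S0 : #|S| = 0 by lia.
  rewrite S0 /forests; move/eqP: S0; rewrite cards_eq0 => /eqP->.
  rewrite -(cards1 ([ffun=> ord_max] : {ffun T -> 'I_B.+1})) -(partial_empty m).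
  apply: eq_card => q; rewrite in_set andbC.
  by have -> : ample c m q by apply/ampleP=> m'; lia.
have [v Ev] : exists v : 'I_B.+1, m = v by exists (Ordinal (mB : m < B.+1)).
subst m.
transitivity #|[set q in partials S v | ample c v q && xpredT q]|.
  by apply: eq_card => q; rewrite !in_set andbT.
rewrite card_ample_layers //.
have [k Ek] : exists k, c - v = k.+1 by exists (c - v).-1; lia.
rewrite Ek forestsS -(sum_subset_card S (fun l => forests (#|S| - l) (k + l))).
apply: eq_bigr => L sLS; have := subset_leq_card sLS => lLS.
case: ifPn => [cL|cL].
  transitivity #|[set q in partials (S :\: L) v.+1 | ample (c + #|L|) v.+1 q]|.
    by apply: eq_card => q; rewrite !in_set andbT.
  rewrite IH ?(card_layer_compl sLS) //; try lia.
  by congr forests; lia.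
(* An inadmissible level corresponds to a forest with nonroots but no roots, and both counts are
   [0]. *)
have -> : k + #|L| = 0 by lia.
by have -> : #|S| - #|L| = (#|S| - #|L|).-1.+1 by lia.
Qed.

Lemma partial_bounds S m q i : q \in partials S m -> i \in S -> m <= q i < B.
Proof. by move=> /maps_toP[qS _] /qS; rewrite inE. Qed.

(** If [b] is not in the level, induction gives [forests1]. If it is, [roomy] says that the excess
    left by the other arguments is positive, and [card_ample] counts the rest. [forests1_compl] adds
    the two, and [forests1S] sums over the levels. *)
Lemma card_roomy1 S m c b : m <= B -> m < c -> #|S| + c = B.+1 -> b \in S ->
  #|[set q in partials S m | ample c m q && roomy c q (q b)]| =
  forests1 #|S :\ b| (c - m).
Proof.
have [d] := ubnP (B - m); elim: d m c S => // d IH m c S dm mB mc Sc bS.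
have Sb : #|S| = #|S :\ b|.+1 by rewrite (cardsD1 b) bS.
have [vB|Bm] := ltnP m B; last by lia.
have [v Ev] : exists v : 'I_B.+1, m = v by exists (Ordinal (mB : m < B.+1)).
subst m; rewrite card_ample_layers // (sum_subsetD1 _ bS).
have [k Ek] : exists k, c - v = k.+1 by exists (c - v).-1; lia.
rewrite Ek forests1S -(sum_subset_card _ (fun l => forests (#|S :\ b| - l).+1 (k + l))).
apply: eq_bigr => L sLb; have := subset_leq_card sLb => lLS.
move: sLb; rewrite subsetD1 => /andP[sLS bL].
have sbLS : b |: L \subset S by rewrite subUset sub1set bS.
have cb : #|b |: L| = #|L|.+1 by rewrite cardsU1 bL.
rewrite -forests1_compl; congr (_ + _).
  case: ifPn => cL; last by have -> : k + #|L| = 0 by lia.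
  transitivity #|[set q in partials (S :\: L) v.+1 |
     ample (c + #|L|) v.+1 q && roomy (c + #|L|) q (q b)]|.
    apply: eq_card => q; rewrite in_set [in RHS]in_set.
    case: (boolP (q \in _)) => //= qP; congr (_ && _).
    have /(partial_bounds qP)/andP[vq qB] : b \in S :\: L by rewrite inE bL.
    by rewrite assign_out // (roomy_assign _ sLS qP) // ltnW.
  have bSL : b \in S :\: L by rewrite inE bL.
  have := card_layer_compl sLS; rewrite (cardsD1 b (S :\: L)) bSL => cSL.
  rewrite IH //; try lia.
  - by congr forests1; lia.
  - by rewrite (card_layer_compl sLS); lia.
rewrite cb; case: (ltnP 0 (k + #|L|)) => kL.
  rewrite ifT; last by lia.
  transitivity #|[set q in partials (S :\: (b |: L)) v.+1 | ample (c + #|L|.+1) v.+1 q]|.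
    apply: eq_card => q; rewrite in_set [in RHS]in_set.
    case: (boolP (q \in _)) => //= qP.
    rewrite assign_in ?setU11 // (roomy_assign _ sbLS qP) // /roomy.
    by rewrite (below_partial qP) // cb; case: (ample _ _ _) => //=; lia.
  rewrite card_ample ?(card_layer_compl sbLS) ?cb //; try lia.
  by congr forests; lia.
case: ifP => // cL; apply/eqP; rewrite cards_eq0; apply/eqP/setP=> q; rewrite in_set in_set0.
apply/negP=> /and3P[qP _].
rewrite assign_in ?setU11 // (roomy_assign _ sbLS qP) // /roomy (below_partial qP) // cb.
by lia.
Qed.

(** Allowing [v = c] lets one lemma serve both the induction, where [v < c], and the initial level
    with [v = c = 0]. If just one of [a] and [b] is in the level, the other has the larger value, so
    [card_roomy1] applies. *)
Lemma card_roomy2_layers S (v : 'I_B.+1) c a b :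
  (forall S' c', v.+1 < c' -> #|S'| + c' = B.+1 -> a \in S' -> b \in S' ->
     #|[set q in partials S' v.+1 |
         ample c' v.+1 q && roomy c' q (maxn (q a) (q b))]| =
     forests2 #|S' :\ a :\ b| (c' - v.+1)) ->
  v < B -> v <= c -> #|S| + c = B.+1 -> a \in S -> b \in S -> a != b ->
  #|[set q in partials S v | ample c v q && roomy c q (maxn (q a) (q b))]| =
  \sum_(l < #|S :\ a :\ b|.+1) 'C(#|S :\ a :\ b|, l) *
    (forests2 (#|S :\ a :\ b| - l) (c + l - v.+1)
     + (forests1 (#|S :\ a :\ b| - l) (c + l - v)).*2
     + if v < c + l then forests (#|S :\ a :\ b| - l) (c + l - v).+1 else 0).
Proof.
move=> IH vB vc Sc aS bS ab.
have Sab : #|S| = #|S :\ a :\ b|.+2.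
  by rewrite (cardsD1 a) aS (cardsD1 b (S :\ a)) !inE eq_sym ab bS.
rewrite card_ample_layers // (sum_subsetD2 _ aS bS ab).
rewrite -(sum_subset_card _ (fun l => forests2 (#|S :\ a :\ b| - l) (c + l - v.+1)
     + (forests1 (#|S :\ a :\ b| - l) (c + l - v)).*2
     + if v < c + l then forests (#|S :\ a :\ b| - l) (c + l - v).+1 else 0)).
apply: eq_bigr => L sL; have Ls := subset_leq_card sL.
move: sL; rewrite !subsetD1 => /andP[/andP[sLS aL] bL].
have saLS : a |: L \subset S by rewrite subUset sub1set aS.
have sbLS : b |: L \subset S by rewrite subUset sub1set bS.
have sabLS : a |: (b |: L) \subset S by rewrite subUset sub1set aS.
have cb : #|b |: L| = #|L|.+1 by rewrite cardsU1 bL.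
have ca : #|a |: L| = #|L|.+1 by rewrite cardsU1 aL.
have abL : a \notin b |: L by rewrite !inE negb_or ab.
have baL : b \notin a |: L by rewrite !inE negb_or eq_sym ab.
have cab : #|a |: (b |: L)| = #|L|.+2 by rewrite cardsU1 abL cb.
rewrite -addnn addnA [in RHS]addnA; congr (_ + _ + _ + _).
- case: ifPn => cL; last first.
    by have -> : c + #|L| - v.+1 = 0 by clear -cL; lia.
  have aSL : a \in S :\: L by rewrite inE aL.
  have bSL : b \in S :\: L by rewrite inE bL.
  transitivity #|[set q in partials (S :\: L) v.+1 |
     ample (c + #|L|) v.+1 q && roomy (c + #|L|) q (maxn (q a) (q b))]|.
    apply: eq_card => q; rewrite in_set [in RHS]in_set.
    case: (boolP (q \in _)) => //= qP; congr (_ && _).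
    have /andP[va aB] := partial_bounds qP aSL.
    have /andP[vb bB] := partial_bounds qP bSL.
    rewrite !assign_out // (roomy_assign _ sLS qP) ?gtn_max ?aB ?bB //.
    by rewrite leq_max (ltnW va).
  have cSL := card_layer_compl sLS.
  rewrite IH //; last by clear -Sc Sab Ls cSL; lia.
  congr forests2; move: cSL.
  rewrite (cardsD1 a) aSL (cardsD1 b (S :\: L :\ a)) [b \in _]in_setD1 eq_sym ab bSL.
  by clear -Sab Ls; lia.
- have aSL : a \in S :\: (b |: L) by rewrite inE abL.
  have cSL := card_layer_compl sbLS.
  rewrite cb; case: ifPn => cL; last first.
    by have -> : c + #|L| - v = 0 by clear -cL; lia.
  transitivity #|[set q in partials (S :\: (b |: L)) v.+1 |
     ample (c + #|L|.+1) v.+1 q && roomy (c + #|L|.+1) q (q a)]|.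
    apply: eq_card => q; rewrite in_set [in RHS]in_set.
    case: (boolP (q \in _)) => //= qP; congr (_ && _).
    have /andP[va aB] := partial_bounds qP aSL.
    rewrite assign_out // assign_in ?setU11 // (maxn_idPl _) ?(ltnW va) //.
    by rewrite (roomy_assign _ sbLS qP) ?cb // ltnW.
  rewrite card_roomy1 ?cSL ?ca ?cb //; try by clear -Sc Sab Ls cL vB; lia.
  congr forests1; last by clear; lia.
  by move: cSL; rewrite (cardsD1 a) aSL cb; clear -Sab Ls; lia.
- have bSL : b \in S :\: (a |: L) by rewrite inE baL.
  have cSL := card_layer_compl saLS.
  rewrite ca; case: ifPn => cL; last first.
    by have -> : c + #|L| - v = 0 by clear -cL; lia.
  transitivity #|[set q in partials (S :\: (a |: L)) v.+1 |
     ample (c + #|L|.+1) v.+1 q && roomy (c + #|L|.+1) q (q b)]|.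
    apply: eq_card => q; rewrite in_set [in RHS]in_set.
    case: (boolP (q \in _)) => //= qP; congr (_ && _).
    have /andP[vb bB] := partial_bounds qP bSL.
    rewrite [assign _ _ _ b]assign_out // assign_in ?setU11 // (maxn_idPr _) ?(ltnW vb) //.
    by rewrite (roomy_assign _ saLS qP) ?ca // ltnW.
  rewrite card_roomy1 ?cSL ?ca ?cb //; try by clear -Sc Sab Ls cL vB; lia.
  congr forests1; last by clear; lia.
  by move: cSL; rewrite (cardsD1 b) bSL ca; clear -Sab Ls; lia.
have cSL := card_layer_compl sabLS.
have roomyE q : q \in partials (S :\: (a |: (b |: L))) v.+1 ->
    roomy c (assign (a |: (b |: L)) v q)
       (maxn (assign (a |: (b |: L)) v q a) (assign (a |: (b |: L)) v q b)) =
    (v < c + #|L|).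
  move=> qP; rewrite !assign_in ?in_setU1 ?eqxx ?orbT // maxnn.
  by rewrite (roomy_assign _ sabLS qP) // /roomy (below_partial qP) // cab; clear; lia.
rewrite cab; case: (ltnP v (c + #|L|)) => cL; last first.
  case: ifP => // _; apply/eqP; rewrite cards_eq0; apply/eqP/setP=> q; rewrite in_set in_set0.
  by apply/negP=> /and3P[qP _]; rewrite roomyE // ltnNge cL.
rewrite ifT; last by clear -cL; lia.
transitivity #|[set q in partials (S :\: (a |: (b |: L))) v.+1 | ample (c + #|L|.+2) v.+1 q]|.
  apply: eq_card => q; rewrite in_set [in RHS]in_set.
  by case: (boolP (q \in _)) => //= qP; rewrite roomyE // cL andbT.
rewrite card_ample ?cSL ?cab //; try by clear -Sc Sab Ls cL vB; lia.
by congr forests; clear -Sc Sab Ls cL; lia.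
Qed.

Lemma card_roomy2 S m c a b : m <= B -> m < c -> #|S| + c = B.+1 ->
  a \in S -> b \in S -> a != b ->
  #|[set q in partials S m | ample c m q && roomy c q (maxn (q a) (q b))]| =
  forests2 #|S :\ a :\ b| (c - m).
Proof.
have [d] := ubnP (B - m); elim: d m c S => // d IH m c S dm mB mc Sc aS bS ab.
have [vB|Bm] := ltnP m B; last first.
  by have : 0 < #|S| by [rewrite card_gt0; apply/set0Pn; exists a]; lia.
have [v Ev] : exists v : 'I_B.+1, m = v by exists (Ordinal (mB : m < B.+1)).
subst m; rewrite card_roomy2_layers //; last by rewrite ltnW.
  have [k Ek] : exists k, c - v = k.+1 by exists (c - v).-1; lia.
  rewrite Ek forests2S; apply: eq_bigr => l _.
  rewrite ifT; last by lia.
  by congr (_ * (forests2 _ _ + (forests1 _ _).*2 + forests _ _)); lia.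
by move=> S' c' vc' Sc' aS' bS'; apply: IH => //; lia.
Qed.

(** The initial level starts with excess [0], so it follows [forest_total] instead of
    [forests2S]. *)
Lemma card_roomy2_total a b : 1 < B -> #|T| = B.+1 -> a != b ->
  #|[set q in partials setT 0 | ample 0 0 q && roomy 0 q (maxn (q a) (q b))]| =
  B ^ (B - 2) * (B - 1) ^ 2.
Proof.
move=> B1 cT ab.
have cTab : #|[set: T] :\ a :\ b| = B.-1.
  have := cardsT T; rewrite cT (cardsD1 a) inE (cardsD1 b ([set: T] :\ a)) !inE eq_sym ab; lia.
rewrite (@card_roomy2_layers _ ord0) ?inE ?cardsT ?cT ?addn0 //.
- rewrite cTab; transitivity (B.-1.+1 ^ B.-1.-1 * B.-1 ^ 2); last first.
    by rewrite prednK; [congr (_ ^ _ * _ ^ _)|]; lia.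
  rewrite -forest_total; last by lia.
  apply: eq_bigr => l _; congr (_ * _).
  (* One of the two [forests1] terms and the conditional term combine, by [forests1_compl], into the
     last term of [forest_total]. *)
  rewrite !add0n subn0 subn1 -addnA -forests1_compl -addnn !addnA.
  by case: ifP.
- by move=> S' c' c1 Sc' aS' bS'; apply: card_roomy2 => //; apply: ltnW.
- exact: ltnW.
Qed.

End Levels.

(** * Spherical parking functions *)

Section MonomialIdeals.
Import GRing.Theory.
Variables (K : fieldType) (n : nat) (G : mgraph 'I_n.+1).

Lemma monoE (A : {set 'I_n}) :
  mono K G A = 'X_[ [multinom (if i \in A then outdeg G A i else 0) | i < n] ]%R.
Proof.
rewrite mpolyXE_id /mono big_mkcond; apply: eq_bigr => i _.
by rewrite mnmE; case: ifP.
Qed.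

(** A monomial in an ideal generated by monomials is divisible by a generator: some product in the
    combination has a nonzero coefficient at it. *)
Lemma ideal_mono_mem (Q : {set 'I_n} -> Prop) (S : {mpoly K[n]} -> Prop) (p : 'I_n -> nat) :
  (forall g, S g <-> exists A, Q A /\ g = mono K G A) ->
  ideal_gen S (\prod_(i < n) 'X_i ^+ p i)%R <->
  exists A, Q A /\ forall i, i \in A -> outdeg G A i <= p i.
Proof.
move=> SE; pose mp := [multinom p i | i < n].
have -> : (\prod_(i < n) 'X_i ^+ p i = 'X_[mp] :> {mpoly K[n]})%R.
  by rewrite mpolyXE_id; apply: eq_bigr => i _; rewrite mnmE.
split=> [[s [sS Ep]]|[A [QA le]]]; last first.
  pose mA := [multinom (if i \in A then outdeg G A i else 0) | i < n].
  have mAp : (mA <= mp)%MM.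
    by apply/mnm_lepP=> i; rewrite !mnmE; case: ifP => // /le.
  exists [:: ('X_[(mp - mA)%MM]%R, mono K G A)]; split.
    by move=> cg; rewrite inE => /eqP->; apply/SE; exists A.
  by rewrite big_seq1 /= monoE -mpolyXD submK.
have: (('X_[mp] : {mpoly K[n]})@_mp != 0)%R by rewrite mcoeffX eqxx oner_neq0.
rewrite Ep raddf_sum /=.
have [/hasP[cg cgs nz] _|/hasPn no] :=
  boolP (has (fun cg => (cg.1 * cg.2)@_mp != 0)%R s); last first.
  by rewrite big_seq big1 ?eqxx // => cg /no/negPn/eqP.
have /SE[A [QA Eg]] := sS _ cgs; exists A; split=> // i iA.
move: nz; rewrite Eg monoE -mcoeff_msupp (perm_mem (msuppMX _ _)) => /mapP[m _ Em].
have := congr1 (fun m : 'X_{1.. n} => m i) Em; rewrite mnmDE !mnmE iA => ->.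
exact: leq_addr.
Qed.

(** Since [(n - 2).+1 = n - 1], the skeleton uses all proper nonempty sets, and the generator
    dividing the monomial must belong to [setT]. *)
Lemma sPFE p : 1 < n ->
  sPF K G p <->
  (forall i, outdeg G setT i <= p i) /\
  (forall A : {set 'I_n}, A != set0 -> #|A| < n -> exists2 i, i \in A & p i < outdeg G A i).
Proof.
move=> n1; rewrite /sPF /idealM /skeletonM.
rewrite (@ideal_mono_mem (fun A => A != set0)) //.
rewrite (@ideal_mono_mem (fun A => A != set0 /\ #|A| <= (n - 2).+1)); last first.
  by move=> g; split=> [[A [? ? ->]]|[A [[? ?] ->]]]; exists A.
have legalP (A : {set 'I_n}) : reflect (exists2 i, i \in A & p i < outdeg G A i)
    (~~ [forall i in A, outdeg G A i <= p i]).
  rewrite negb_forall_in; apply: (iffP exists_inP) => -[i iA H]; exists i => //.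
  - by rewrite ltnNge.
  - by rewrite -ltnNge.
split=> [[[A [A0 le]] nosk]|[le illegal]].
  have small (C : {set 'I_n}) : C != set0 -> #|C| < n -> exists2 i, i \in C & p i < outdeg G C i.
    move=> C0 Cn; apply/legalP/negP => /forall_inP leC; apply: nosk.
    by exists C; split=> //; split=> //; lia.
  split=> // i; suff AT : A = setT by rewrite -AT le // AT inE.
  apply/eqP; rewrite eqEcard subsetT cardsT card_ord leqNgt; apply/negP => An.
  by have [j /le] := small A A0 An; rewrite leqNgt => /negbTE->.
split.
  exists setT; split; last by [].
  by apply/set0Pn; exists (Ordinal (ltnW n1)); rewrite inE.
case=> A [[A0 An] leA].
have [|j /leA] := illegal A A0; last by rewrite leqNgt => /negbTE->.
by apply: leq_ltn_trans An _; lia.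
Qed.

End MonomialIdeals.

(** * Threshold conditions for the complete graph without an edge *)

Section CompleteMinusEdge.
Variables (n : nat) (a b : 'I_n).
Hypothesis ab : a != b.

Let G := del_edge (complete_graph n) (vtx a) (vtx b).

(** For [i] in [A], this is [1] exactly when the deleted edge leads from [i] out of [A]. *)
Definition crossing (A : {set 'I_n}) (i : 'I_n) : nat :=
  ((i == a) && (b \notin A)) + ((i == b) && (a \notin A)).

Lemma vtx_inj : injective (@vtx n).
Proof. exact: lift_inj. Qed.

(** The successor accounts for the vertex [0]; the sum form avoids truncated subtraction. *)
Lemma outdeg_del_edge (A : {set 'I_n}) i : i \in A ->
  outdeg G A i + crossing A i = (n - #|A|).+1.
Proof.
move=> iA; rewrite /outdeg.
have mC (j : 'I_n) : (vtx j \in ~: (@vtx n @: A)) = (j \notin A).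
  by rewrite inE mem_imset //; apply: vtx_inj.
have cC : #|~: (@vtx n @: A)| = (n - #|A|).+1.
  rewrite cardsCs setCK card_ord card_imset; last exact: vtx_inj.
  by rewrite subSn // -[X in _ <= X]card_ord max_card.
have -> : crossing A i =
    \sum_(v in ~: (@vtx n @: A)) ([set vtx i; v] == [set vtx a; vtx b]).
  rewrite /crossing.
  transitivity (\sum_(v in ~: (@vtx n @: A))
      (((i == a) && (v == vtx b)) + ((i == b) && (v == vtx a)))).
    rewrite big_split /=; congr (_ + _).
    - case: (i == a) => /=; last by rewrite big1.
      rewrite -mC; case: (boolP (vtx b \in _)) => bC.
        rewrite (bigD1 (vtx b)) //= eqxx big1 // => v /andP[_ /negbTE->] //.
      by rewrite big1 // => v vC; case: eqP => // vb; rewrite -vb vC in bC.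
    - case: (i == b) => /=; last by rewrite big1.
      rewrite -mC; case: (boolP (vtx a \in _)) => aC.
        rewrite (bigD1 (vtx a)) //= eqxx big1 // => v /andP[_ /negbTE->] //.
      by rewrite big1 // => v vC; case: eqP => // va; rewrite -va vC in aC.
  apply: eq_bigr => v _.
  have [->|ia] := eqVneq i a; first rewrite (negbTE ab) addn0 /=.
    congr nat_of_bool; apply/eqP/set2_eqP => [->|[[]//|[/vtx_inj Eab]]]; first by left.
    by move: ab; rewrite Eab eqxx.
  rewrite add0n; congr nat_of_bool; apply/andP/set2_eqP => [[/eqP-> /eqP->]|]; first by right.
  by case=> -[/vtx_inj Ei ->]; [rewrite Ei eqxx in ia | rewrite Ei !eqxx].
rewrite -big_split /= -cC -sum1_card; apply: eq_bigr => v vC.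
have -> : vtx i != v by apply: contraTneq vC => <-; rewrite mC iA.
by case: eqP.
Qed.

Lemma crossing0 (A : {set 'I_n}) i : i \in A -> (a \in A) = (b \in A) -> crossing A i = 0.
Proof.
move=> iA abA; rewrite /crossing.
have [ia|_] /= := eqVneq i a; have [ib|_] //= := eqVneq i b.
- by rewrite -abA -ia iA.
- by rewrite -abA -ia iA.
- by rewrite abA -ib iA.
Qed.

Section Threshold.
Variables (B : nat) (q : 'I_n -> nat).
Hypothesis nB : n = B.+1.

Let below m := #|[set i | q i < m]|.

Lemma card_above m : #|[set i | m <= q i]| = n - below m.
Proof.
rewrite /below -[X in X - _]card_ord -[#|'I_n|]cardsT -(cardsID [set i | q i < m] setT) setTI addnC.
rewrite addnK; apply: eq_card => i; by rewrite !inE andbT -leqNgt.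
Qed.

Lemma below_le m : below m <= n.
Proof. by rewrite -[X in _ <= X]card_ord max_card. Qed.

(** If [below m <= m], the set where [q] is at least [m] violates the hypothesis, as [n - #|A|] is
    then [below m]. *)
Lemma legal_free_ample :
  (forall A : {set 'I_n}, A != set0 -> #|A| < n ->
     exists2 i, i \in A & q i + crossing A i < n - #|A|) ->
  forall m, 0 < m -> m <= B -> m < below m.
Proof.
clear ab; move=> free m m0 mB; rewrite ltnNge; apply/negP=> le.
(* If [below m] is [0], that set is not proper; a complement of one point forces a zero of [q]
   instead. *)
have [b0|b0] := posnP (below m).
  have cx : #|[set~ a]| = B by rewrite cardsC1 card_ord nB.
  have [||i _] := free [set~ a].
  - by rewrite -card_gt0 cx; lia.
  - by rewrite cx nB.
  rewrite cx (_ : n - B = 1) ?ltnS ?leqn0; last by rewrite nB subSnn.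
  rewrite addn_eq0 => /andP[/eqP qi _].
  have : i \in [set i | q i < m] by rewrite inE qi.
  by move/card0_eq: b0 => ->.
have [||i] := free [set i | m <= q i].
- by rewrite -card_gt0 card_above; lia.
- by rewrite card_above; lia.
rewrite inE card_above => mi; have := below_le m; lia.
Qed.

(** Otherwise [a] together with all [i] having [q i > q a] is a violating set: the deleted edge
    raises the left side at [a] by one. *)
Lemma legal_free_roomy : (q b <= q a) ->
  (forall A : {set 'I_n}, A != set0 -> #|A| < n ->
     exists2 i, i \in A & q i + crossing A i < n - #|A|) ->
  (q a).+2 < below (q a).+1.
Proof.
clear nB; move=> qba free; rewrite ltnNge; apply/negP=> le.
pose A := a |: [set i | (q a).+1 <= q i].
have cA : #|A| = (n - below (q a).+1).+1 by rewrite cardsU1 inE ltnn card_above.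
have bA : b \notin A by rewrite !inE negb_or eq_sym ab -leqNgt.
have An : #|A| < n.
  rewrite ltnNge; apply: contra bA => An.
  suff -> : A = setT by rewrite inE.
  by apply/eqP; rewrite eqEcard subsetT cardsT card_ord.
have A0 : A != set0 by apply/set0Pn; exists a; rewrite setU11.
have [i] := free A A0 An; have := below_le (q a).+1.
rewrite cA !in_setU1 inE => leb /orP[/eqP->|qi].
  by rewrite /crossing eqxx bA (negbTE ab) /= addn0 addn1; lia.
by lia.
Qed.

(** For [m = n - #|A|], ampleness makes the set where [q] is at least [m] equal to [A :\ a]. Hence
    the maximum is [m.-1], and roominess demands fewer than [#|A| - 1] such elements. *)
Lemma roomy_not_legal (A : {set 'I_n}) :
  (forall m, 0 < m -> m <= B -> m < below m) ->
  (maxn (q a) (q b)).+2 < below (maxn (q a) (q b)).+1 ->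
  #|A| < n -> a \in A -> b \notin A ->
  ~ (forall i, i \in A -> n - #|A| <= q i + crossing A i).
Proof.
move=> amp room An aA bA legal; set m := n - #|A| in legal.
have A0 : 0 < #|A| by rewrite card_gt0; apply/set0Pn; exists a.
have sub : A :\ a \subset [set i | m <= q i].
  apply/subsetP=> i; rewrite !inE => /andP[ia iA]; have := legal i iA.
  rewrite /crossing (negbTE ia) /= add0n; case: eqP => [ib|_]; last by rewrite addn0.
  by rewrite ib (negbTE bA) in iA.
have cA : #|A| = #|A :\ a|.+1 by rewrite (cardsD1 a) aA.
have qa : m <= (q a).+1.
  by have := legal a aA; rewrite /crossing eqxx bA (negbTE ab) /= addn0 addn1.
have mB : 0 < m <= B by rewrite /m; lia.
have bm : m < below m by case/andP: mB; apply: amp.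
have big x : x \notin A :\ a -> q x < m.
  move=> xA; rewrite ltnNge; apply/negP=> mx.
  have : x |: (A :\ a) \subset [set i | m <= q i] by rewrite subUset sub1set inE mx.
  move/subset_leq_card; rewrite cardsU1 xA card_above /= add1n -cA.
  by have := below_le m; move: bm An; rewrite /m; clear; lia.
have qam : q a < m by apply: big; rewrite !inE eqxx.
have qbm : q b < m by apply: big; rewrite inE negb_and bA orbT.
have Em : maxn (q a) (q b) = m.-1 by lia.
move: room; rewrite Em prednK; last by case/andP: mB.
have := subset_leq_card sub; rewrite card_above.
by have := below_le m; move: An A0 mB cA; rewrite /m; clear; lia.
Qed.

End Threshold.

End CompleteMinusEdge.

Lemma crossingC n (a b : 'I_n) : crossing a b =2 crossing b a.
Proof. by move=> A i; rewrite /crossing addnC. Qed.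

(** If a violating [A] does not separate [a] from [b], the crossing terms vanish and ampleness
    bounds its size; otherwise [roomy_not_legal] applies, up to exchanging [a] and [b]. *)
Lemma ample_roomy_free n B (a b : 'I_n) (q : 'I_n -> nat) : a != b -> n = B.+1 ->
  (forall m, 0 < m -> m <= B -> m < #|[set i | q i < m]|) ->
  (maxn (q a) (q b)).+2 < #|[set i | q i < (maxn (q a) (q b)).+1]| ->
  forall A : {set 'I_n}, A != set0 -> #|A| < n ->
     exists2 i, i \in A & q i + crossing a b A i < n - #|A|.
Proof.
move=> ab nB amp room A A0 An.
have [/exists_inP //|] := boolP [exists i in A, q i + crossing a b A i < n - #|A|].
rewrite negb_exists_in => /forall_inP legal; exfalso.
have {}legal i : i \in A -> n - #|A| <= q i + crossing a b A i.
  by move/legal; rewrite -leqNgt.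
have [abA|] := eqVneq (a \in A) (b \in A).
  have : A \subset [set i | n - #|A| <= q i].
    by apply/subsetP=> i iA; rewrite inE; have := legal i iA; rewrite crossing0 ?addn0.
  move/subset_leq_card; rewrite card_above; rewrite -card_gt0 in A0.
  have := amp (n - #|A|); have := below_le q (n - #|A|).
  by move: A0 An nB; clear; lia.
case: (boolP (a \in A)) => aA; case: (boolP (b \in A)) => bA // _.
  exact: (roomy_not_legal ab nB amp room An aA bA legal).
rewrite eq_sym in ab; rewrite maxnC in room.
by apply: (roomy_not_legal ab nB amp room An bA aA) => i iA; rewrite crossingC legal.
Qed.

Lemma free_roomy n (a b : 'I_n) (q : 'I_n -> nat) : a != b ->
  (forall A : {set 'I_n}, A != set0 -> #|A| < n ->
     exists2 i, i \in A & q i + crossing a b A i < n - #|A|) ->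
  (maxn (q a) (q b)).+2 < #|[set i | q i < (maxn (q a) (q b)).+1]|.
Proof.
move=> ab free; case: (leqP (q a) (q b)) => [|/ltnW] qab.
  apply: (@legal_free_roomy _ b a) => //; first by rewrite eq_sym.
  by move=> A A0 An; have [i iA] := free A A0 An; exists i; rewrite // crossingC.
exact: (@legal_free_roomy _ a b).
Qed.

Lemma has_card_sPF (K : fieldType) (n : nat) (a b : 'I_n) : 3 <= n -> a != b ->
  has_card (sPF K (del_edge (complete_graph n) (vtx a) (vtx b)))
           ((n - 1) ^ (n - 3) * (n - 2) ^ 2).
Proof.
case: n a b => // B a b B2 ab.
pose Q := [set q in partials B [set: 'I_B.+1] 0 | ample 0 0 q && roomy 0 q (maxn (q a) (q b))].
have freeE (p : {ffun 'I_B.+1 -> nat}) :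
    sPF K (del_edge (complete_graph B.+1) (vtx a) (vtx b)) p <->
    (forall i, 0 < p i) /\
    (forall A : {set 'I_B.+1}, A != set0 -> #|A| < B.+1 ->
       exists2 i, i \in A & (p i).-1 + crossing a b A i < B.+1 - #|A|).
  rewrite sPFE; last by apply: ltnW.
  have out1 i : outdeg (del_edge (complete_graph B.+1) (vtx a) (vtx b)) setT i = 1.
    have := outdeg_del_edge ab (in_setT i).
    by rewrite cardsT card_ord subnn crossing0 ?inE // addn0.
  split=> -[p0 free]; (split=> [i|A A0 An]; first by have := p0 i; rewrite out1).
    have [i iA lt] := free A A0 An; exists i => //.
    have pi0 := p0 i; rewrite out1 in pi0.
    by rewrite -ltnS -(outdeg_del_edge ab iA) -addSn prednK // ltn_add2r.
  have [i iA lt] := free A A0 An; exists i => //.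
  rewrite -(ltn_add2r (crossing a b A i)) (outdeg_del_edge ab iA).
  by rewrite -(prednK (p0 i)) addSn ltnS.
exists [seq [ffun i => (q i).+1] | q : {ffun 'I_B.+1 -> 'I_B.+1} <- enum Q]; split.
- rewrite map_inj_uniq ?enum_uniq // => q q' /ffunP E; apply/ffunP=> i.
  by have := E i; rewrite !ffunE => -[] /val_inj.
- move=> p; split.
    case/mapP=> q; rewrite mem_enum in_set => /and3P[qP /ampleP amp room] ->.
    apply/freeE; split=> [i|A A0 An]; first by rewrite ffunE.
    have [i iA lt] := @ample_roomy_free _ B a b (fun i => q i) ab erefl
      (fun m m0 mB => leq_trans (amp m m0 mB) (eq_leq (addn0 _)))
      (leq_trans room (eq_leq (addn0 _))) A A0 An.
    by exists i; rewrite ?ffunE.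
  case/freeE=> p0 free.
  have amp := @legal_free_ample _ a b B (fun i => (p i).-1) erefl free.
  have room := @free_roomy _ a b (fun i => (p i).-1) ab free.
  (* Ampleness at [B] puts all [B.+1] values below [B], which frees [B] as the dummy value. *)
  have pB i : (p i).-1 < B.
    have := amp B (ltnW B2) (leqnn _); rewrite ltnNge; apply: contraNT => nlt.
    rewrite -[X in _ <= X]/(B.+1.-1) -[X in _ <= X.-1]card_ord -(cardsC1 i) subset_leq_card //.
    by apply/subsetP=> j; rewrite !inE; apply: contraTneq => ->.
  have pB' i : (p i).-1 < B.+1 by apply: leqW.
  apply/mapP; exists [ffun i => inord (p i).-1]; last first.
    by apply/ffunP=> i; rewrite !ffunE inordK //; rewrite prednK.
  have below_p m : below [ffun i => inord (p i).-1 : 'I_B.+1] m = #|[set i | (p i).-1 < m]|.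
    by apply: eq_card => i; rewrite !inE ffunE inordK.
  rewrite mem_enum in_set; apply/and3P; split.
  + by apply/maps_toP; split=> i; rewrite ?in_setT // => _; rewrite inE ffunE inordK // pB.
  + by apply/ampleP=> m m0 mB; rewrite below_p addn0; apply: amp.
  + by rewrite /roomy below_p addn0 !ffunE !inordK.
rewrite size_map -cardE card_roomy2_total ?card_ord //.
by congr (_ ^ _ * _ ^ _); lia.
Qed.

Theorem theorem3p10 (K : fieldType) (n : nat) (hn : 3 <= n) (i j : 'I_n.+1)
    (hi : i != ord0) (hj : j != ord0) (hij : i != j) :
  has_card (sPF K (del_edge (complete_graph n) i j))
           ((n - 1) ^ (n - 3) * (n - 2) ^ 2) /\
  has_card (@uprooted' n) ((n - 1) ^ (n - 3) * (n - 2) ^ 2).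
Proof.
split.
  rewrite eq_sym in hi; rewrite eq_sym in hj.
  have [a ia _] := unlift_some hi; have [b jb _] := unlift_some hj; subst i j.
  by apply: has_card_sPF => //; apply: contraNneq hij => ->.
case: n hn {i j hi hj hij} => // m hn.
exact: (@has_card_uprooted' _ ord0 ord_max).
Qed.
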